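(* There is a uniformly discrete set $\Lambda\subset\mathbb{R}$ with uniform density $D(\Lambda)=1$ such that, for every $0<\delta<1$, $\Lambda$ is a uniqueness set for $X_S$ with $S=[0,1-\delta]+\mathbb{Z}$.
   Context: $X$ denotes the space of continuous functions on $\mathbb{R}$ of at most polynomial growth; each $f\in X$ is a tempered (Schwartz) distribution. The spectrum of $f\in X$ is the minimal closed set $S$ such that $\int_{\mathbb{R}} f(t)\varphi(t)\,dt=0$ for every test function $\varphi$ whose Fourier transform $\hat\varphi$ vanishes in a neighbourhood of $S$ (Fourier transform $\hat\varphi(t)=\int e^{-2\pi i t x}\varphi(x)\,dx$). For a closed set $S$, $X_S$ is the subspace of $X$ of functions with spectrum in $S$. A set $\Lambda$ is uniformly discrete if $\inf\{|\lambda-\lambda'|:\lambda\neq\lambda'\in\Lambda\}>0$; it has uniform density $D(\Lambda)$ if $\mathrm{Card}(\Lambda\cap(x,x+r))=rD(\Lambda)+o(r)$ uniformly in $x$ as $r\to\infty$. $\Lambda$ is a uniqueness set for $X_S$ if $f\in X_S$, $f|_\Lambda=0$ imply $f=0$. *)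

(* Defs.v *)
(* Complex-valued functions R -> C are represented
   as pairs (real part, imaginary part) of real functions R -> R. *)
From HB Require Import structures.
From mathcomp Require Import all_boot all_order all_algebra.
From mathcomp Require Import all_classical all_reals all_analysis.
Set Implicit Arguments. Unset Strict Implicit. Unset Printing Implicit Defensive.
Import Order.TTheory GRing.Theory Num.Theory.
Import numFieldNormedType.Exports.
Local Open Scope classical_set_scope.
Local Open Scope ring_scope.

Section Defs.
Variable R : realType.

Definition cfun := ((R -> R) * (R -> R))%type.

Definition poly_growth (g : R -> R) : Prop :=
  exists (C : R) (N : nat), forall x : R, `|g x| <= C * (1 + `|x|) ^+ N.

Definition inX (f : cfun) : Prop :=
  continuous f.1 /\ continuous f.2 /\ poly_growth f.1 /\ poly_growth f.2.

Definition schwartzR (g : R -> R) : Prop :=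
  (forall (n : nat) (x : R), derivable (derive1n n g) x 1) /\
  (forall k n : nat, exists C : R, forall x : R, `|x ^+ k * derive1n n g x| <= C).

Definition schwartz (phi : cfun) : Prop := schwartzR phi.1 /\ schwartzR phi.2.

Definition integral (g : R -> R) : R := Rintegral lebesgue_measure setT g.

(* Fourier transform  hat phi (t) = int e^{-2 pi i t x} phi(x) dx,
   real and imaginary parts *)
Definition fourier_re (phi : cfun) (t : R) : R :=
  integral (fun x => phi.1 x * cos (2 * pi * t * x) + phi.2 x * sin (2 * pi * t * x)).
Definition fourier_im (phi : cfun) (t : R) : R :=
  integral (fun x => phi.2 x * cos (2 * pi * t * x) - phi.1 x * sin (2 * pi * t * x)).

Definition fourier_vanishes_near (phi : cfun) (S : set R) : Prop :=
  exists U : set R, open U /\ S `<=` U /\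
    forall t, U t -> fourier_re phi t = 0 /\ fourier_im phi t = 0.

(* int f phi = 0 (real and imaginary parts) *)
Definition pairing_zero (f phi : cfun) : Prop :=
  integral (fun x => f.1 x * phi.1 x - f.2 x * phi.2 x) = 0 /\
  integral (fun x => f.1 x * phi.2 x + f.2 x * phi.1 x) = 0.

Definition spectrum_in (f : cfun) (S : set R) : Prop :=
  forall phi : cfun, schwartz phi -> fourier_vanishes_near phi S -> pairing_zero f phi.

Definition inXS (S : set R) (f : cfun) : Prop := inX f /\ spectrum_in f S.

Definition uniformly_discrete (L : set R) : Prop :=
  exists d : R, 0 < d /\ forall l l', L l -> L l' -> l <> l' -> d <= `|l - l'|.

Definition has_uniform_density (L : set R) (D : R) : Prop :=
  forall eps : R, 0 < eps -> exists r0 : R, forall r x : R, r0 <= r ->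
    exists s : seq R, uniq s /\
      (forall y, y \in s <-> (L y /\ x < y < x + r)) /\
      `|(size s)%:R - r * D| <= eps * r.

Definition uniqueness_set (L : set R) (S : set R) : Prop :=
  forall f : cfun, inXS S f -> (forall l, L l -> f.1 l = 0 /\ f.2 l = 0) ->
    forall x, f.1 x = 0 /\ f.2 x = 0.

Definition S_delta (delta : R) : set R :=
  [set t | exists k : int, 0 <= t - k%:~R <= 1 - delta].

End Defs.

(* Main.v *)
(* Restricting f in X_S to a coset x + Z gives a sequence of polynomial growth
   whose spectrum on the circle misses an arc of length delta.  Such a sequence
   annihilates the Fourier coefficients (c_n) of every smooth function psi
   supported in the arc.  Applying to psi the operators ((i / 2 pi) D - j) / (m - j),
   which multiply c_n by (n - j) / (m - j), one gets c_m = 1 and c_n = 0 for the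
   other |n| <= a.  As (c_n) is rapidly decreasing, f (x + m) is therefore as small
   as we please if f vanishes at x + n for a < |n| <= b, with b large depending
   on a, the gap and the growth only.  Hence the set: split Z into blocks
   a_k < |n| <= a_{k+1} with a_{k+1} chosen large after a_k, and translate the k-th
   block by x_k in [0, 1), where every point of [0, 1) is a limit point of the x_k.

   To test f against (c_n) one uses the Schwartz functions
   sum_n c_n u (t - n) with u a bump function near x: their Fourier transform is
   that of u times the Fourier series of (c_n), which vanishes near S. *)
Require Import Defs.
From HB Require Import structures.
From mathcomp Require Import all_boot all_order all_algebra.
From mathcomp Require Import all_classical all_reals all_analysis.
From mathcomp Require Import measurable_realfun ring lra zify.
Set Implicit Arguments. Unset Strict Implicit. Unset Printing Implicit Defensive.
Import Order.TTheory GRing.Theory Num.Theory.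
Import numFieldNormedType.Exports.
Local Open Scope classical_set_scope.
Local Open Scope ring_scope.

(** One set has to serve every gap length, every growth order and every precision at once. The index
    [k] therefore carries all three: the k-th block handles gaps of length at least 1/(k+2), growth
    of order at most [k], and an error 1/(k+1) up to a constant depending on f. A given f is within
    the reach of all large [k]. Vanishing on a finite block never forces f to vanish at x_k + m, it
    only makes f small there; the exact zero at x comes from continuity, along blocks whose offsets
    tend to the fractional part of x.

    The spectrum sees f only through integrals, whereas the hypothesis concerns point values. Hence
    the main bound is proved proportional to the mass of the bump [u], so that it survives the
    shrinking of [u] to a point.

    The Fourier series of (c_n) is handled through symmetric partial sums, which the Dirichlet
    kernel turns into a single integral. Complex sequences are carried as pairs, c = [c1] + i [c2],
    so that most identities come in twos. *)

(** * Smooth functions with explicit derivatives, and bumps *)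

Section SmoothFunctions.
Variable R : realType.
Implicit Types (f g u v F G : R -> R) (t x y : R).

(** Taking a polynomial in 1/x as a factor keeps the family closed under differentiation: the
    derivative of p(1/x) e^{-1/x} has the same form, with [p] replaced by X^2 (p - p'). *)
Definition flat (p : {poly R}) (x : R) : R :=
  if 0 < x then p.[x^-1] * expR (- x^-1) else 0.

(** This is e^s >= s at s = y/n, raised to the power n. *)
Lemma exprn_le_expR (n : nat) (y : R) : 0 <= y -> y ^+ n <= n%:R ^+ n * expR y.
Proof.
case: n => [|n] y0; first by rewrite !expr0 mul1r -expR0 ler_expR.
have n0 : n.+1%:R != 0 :> R by rewrite pnatr_eq0.
have -> : expR y = expR (y / n.+1%:R) ^+ n.+1.
  by rewrite -expRM_natl mulrC mulfVK.
rewrite -exprMn; apply: lerXn2r; rewrite ?nnegrE ?mulr_ge0 ?expR_ge0//.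
rewrite -ler_pdivrMl ?ltr0n// mulrC.
by apply: le_trans (expR_ge1Dx _); rewrite lerDr.
Qed.

Lemma horner_le_expR (p : {poly R}) :
  exists2 C : R, 0 <= C & forall y, 0 <= y -> `|p.[y]| <= C * expR y.
Proof.
exists (\sum_(i < size p) `|p`_i| * i%:R ^+ i) => [|y y0].
  by apply: sumr_ge0 => i _; rewrite mulr_ge0 ?exprn_ge0.
rewrite horner_coef mulr_suml; apply: le_trans (ler_norm_sum _ _ _) _.
apply: ler_sum => i _; rewrite normrM -mulrA ler_wpM2l//.
by rewrite ger0_norm ?exprn_ge0// exprn_le_expR.
Qed.

(** Bound y^2 p(y) by C e^y at y = 1/x. The quadratic order is what makes the derivative at 0 exist
    and vanish. *)
Lemma flat_le_sqr (p : {poly R}) :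
  exists2 C : R, 0 <= C & forall x, `|flat p x| <= C * x ^+ 2.
Proof.
have [C C0 HC] := horner_le_expR ('X^2 * p); exists C => // x.
rewrite /flat; case: ifP => [x0|_]; last by rewrite normr0 mulr_ge0 ?sqr_ge0.
have xV0 : 0 <= x^-1 by rewrite invr_ge0 ltW.
have := HC _ xV0; rewrite hornerM hornerXn normrM (ger0_norm (exprn_ge0 _ _))//.
rewrite normrM (ger0_norm (expR_ge0 _)) expRN => h.
rewrite ler_pdivrMr ?expR_gt0//.
rewrite -(ler_pM2l (exprn_gt0 2 (_ : 0 < x^-1))) ?invr_gt0//.
apply: le_trans h _; rewrite le_eqVlt; apply/orP; left; apply/eqP.
by field; rewrite gt_eqF.
Qed.

Lemma is_derive_flat (p : {poly R}) (x : R) :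
  is_derive x 1 (flat p) (flat ('X^2 * (p - p^`())) x).
Proof.
have [x0|x0|->] := ltgtP x 0.
- have -> : flat ('X^2 * (p - p^`())) x = 0 by rewrite /flat ltNge ltW.
  apply: (near_eq_is_derive _ (is_derive_cst 0 x 1)).
  by near=> z; rewrite /flat ltNge ltW//=; near: z; exact: lt_nbhsl.
- have -> : flat ('X^2 * (p - p^`())) x =
      ('X^2 * (p - p^`())).[x^-1] * expR (- x^-1) by rewrite /flat x0.
  have xn0 : x != 0 by rewrite gt_eqF.
  have dV : is_derive x 1 (fun z : R => z^-1) (- (x ^- 2)).
    have := @is_deriveV R id x 1 1 xn0 (is_derive_id _ _).
    by rewrite /GRing.scale/= mulr1.
  have dp : is_derive x^-1 1 (horner p) (p^`().[x^-1]).
    by have := derivableP (@derivable_horner _ p x^-1); rewrite -derive1E -derivE.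
  have d1 : is_derive x 1 (fun z : R => p.[z^-1]) (p^`().[x^-1] * - (x ^- 2)).
    exact: (@is_derive1_comp _ (horner p) (fun z : R => z^-1)).
  have d2 : is_derive x 1 (fun z : R => expR (- z^-1)) (expR (- x^-1) * (x ^- 2)).
    have dN : is_derive x 1 (fun z : R => - z^-1) (x ^- 2).
      by have := is_deriveN dV; rewrite opprK.
    exact: (@is_derive1_comp _ expR (fun z : R => - z^-1)).
  rewrite (_ : _ * _ = p.[x^-1] * (expR (- x^-1) * x ^- 2) +
      expR (- x^-1) * (p^`().[x^-1] * - x ^- 2)); last first.
    by rewrite hornerM hornerXn hornerD hornerN -exprVn; ring.
  apply: (near_eq_is_derive _ (is_deriveM d1 d2)).
  by near=> z; rewrite /flat ifT//; near: z; exact: lt_nbhsr.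
- have -> : flat ('X^2 * (p - p^`())) 0 = 0 by rewrite /flat ltxx.
  have [C C0 HC] := flat_le_sqr p.
  have H : h^-1 *: (flat p (h *: 1 + 0) - flat p 0) @[h --> 0^'] --> (0 : R).
    apply/cvgrPdist_le => e e0; near=> h.
    have hn0 : h != 0 by near: h; exact: nbhs_dnbhs_neq.
    rewrite sub0r normrN /GRing.scale/= mulr1 addr0 [flat p 0]/flat ltxx subr0.
    rewrite normrM normfV.
    rewrite ler_pdivrMl ?normr_gt0// mulrC.
    apply: le_trans (HC h) _; rewrite -real_normK ?num_real// expr2 mulrA.
    rewrite ler_wpM2r//.
    (* The difference quotient is at most C |h|; dividing by [C + 1] is safe even if [C] is 0. *)
    have he : `|h| <= e / (C + 1).
      near: h; apply: dnbhs0_le; rewrite divr_gt0//; lra.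
    have : (C + 1) * `|h| <= e by rewrite mulrC -ler_pdivlMr//; lra.
    have := normr_ge0 h; nra.
  apply: DeriveDef; first by apply/cvg_ex; exists 0.
  exact: cvg_lim.
Unshelve. all: by end_near. Qed.

(* Large enough to contain bump functions and trigonometric polynomials, and
   closed under differentiation by construction. *)
Inductive sm : (R -> R) -> Prop :=
| sm_flat p : sm (flat p)
| sm_cst c : sm (fun=> c)
| sm_cos : sm cos
| sm_sin : sm sin
| sm_add f g : sm f -> sm g -> sm (fun x => f x + g x)
| sm_mul f g : sm f -> sm g -> sm (fun x => f x * g x)
| sm_affine a b f : sm f -> sm (fun x => f (a * x + b)).

Lemma sm_is_derive f : sm f ->
  exists2 f', sm f' & forall x, is_derive x 1 f (f' x).
Proof.
elim => {f} [p|c|||f g _ [f' sf' df] _ [g' sg' dg]|f g sf [f' sf' df] sg [g' sg' dg]|a b f sf [f' sf' df]].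
- by exists (flat ('X^2 * (p - p^`()))); [exact: sm_flat|move=> x; exact: is_derive_flat].
- by exists (fun=> 0); [exact: sm_cst|move=> x; exact: is_derive_cst].
- exists (fun x => -1 * sin x); first by apply: sm_mul sm_sin; exact: sm_cst.
  by move=> x; rewrite mulN1r; exact: is_derive_cos.
- by exists cos; [exact: sm_cos|move=> x; exact: is_derive_sin].
- by exists (fun x => f' x + g' x); [exact: sm_add|move=> x; exact: is_deriveD].
- exists (fun x => f x * g' x + g x * f' x); first by apply: sm_add; exact: sm_mul.
  by move=> x; exact: is_deriveM.
- exists (fun x => f' (a * x + b) * a).
    by apply: sm_mul (sm_cst a); exact: sm_affine.
  move=> x; apply: (@is_derive1_comp _ f (fun x => a * x + b)).
  have := is_deriveD (is_deriveZ a (is_derive_id x 1)) (is_derive_cst b x 1).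
  by rewrite addr0 /GRing.scale/= mulr1.
Qed.

Lemma sm_derivable {f} : sm f -> forall x, derivable f x 1.
Proof. by case/sm_is_derive => f' _ df x; case: (df x). Qed.

Lemma sm_derive1 f : sm f -> sm (derive1 f).
Proof.
case/sm_is_derive => f' sf' df; suff -> : derive1 f = f' by [].
by apply/funext => x; rewrite derive1E; exact: derive_val.
Qed.

Lemma sm_continuous f : sm f -> continuous f.
Proof.
by move=> sf x; apply/differentiable_continuous/derivable1_diffP/sm_derivable.
Qed.

Lemma sm_derive1n f n : sm f -> sm (derive1n n f).
Proof. by move=> sf; elim: n => // n; rewrite derive1nS; exact: sm_derive1. Qed.

Lemma sm_opp f : sm f -> sm (fun x => - f x).
Proof.
move=> sf; suff -> : (fun x => - f x) = (fun x => -1 * f x).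
  by apply: sm_mul sf; exact: sm_cst.
by apply/funext => x; rewrite mulN1r.
Qed.

Lemma sm_sub f g : sm f -> sm g -> sm (fun x => f x - g x).
Proof. by move=> sf /sm_opp; exact: sm_add. Qed.

Lemma sm_scale c f : sm f -> sm (fun x => c * f x).
Proof. by apply: sm_mul; exact: sm_cst. Qed.

Definition bumpf (c e x : R) : R := flat 1 (x - c + e) * flat 1 (c + e - x).

Lemma sm_bumpf c e : sm (bumpf c e).
Proof.
rewrite /bumpf; apply: sm_mul.
  rewrite (_ : (fun x => _) = (fun x => flat 1 (1 * x + (e - c)))).
    by apply: sm_affine; exact: sm_flat.
  by apply/funext => x; congr flat; ring.
rewrite (_ : (fun x => _) = (fun x => flat 1 (-1 * x + (c + e)))).
  by apply: sm_affine; exact: sm_flat.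
by apply/funext => x; congr flat; ring.
Qed.

Lemma flat1_ge0 x : 0 <= flat 1 x.
Proof. by rewrite /flat; case: ifP => //; rewrite hornerC mul1r expR_ge0. Qed.

Lemma bumpf_ge0 c e x : 0 <= bumpf c e x.
Proof. by rewrite mulr_ge0 ?flat1_ge0. Qed.

Lemma bumpf_gt0 c e x : c - e < x < c + e -> 0 < bumpf c e x.
Proof.
move=> /andP[h1 h2]; rewrite /bumpf /flat !ifT; [|lra|lra].
by rewrite !hornerC !mul1r mulr_gt0 ?expR_gt0.
Qed.

Lemma bumpf_eq0 c e x : ~~ (c - e < x < c + e) -> bumpf c e x = 0.
Proof.
rewrite negb_and -!leNgt /bumpf /flat => /orP[h|h].
  by rewrite ifF ?mul0r//; apply/negbTE; rewrite -leNgt; lra.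
by rewrite [X in _ * X]ifF ?mulr0//; apply/negbTE; rewrite -leNgt; lra.
Qed.

End SmoothFunctions.

(** * Integrals of functions that vanish outside a segment *)

Section CompactSupport.
Variable R : realType.
Implicit Types (f g u v F G : R -> R) (p q t x y : R).
Local Notation mu := (@lebesgue_measure R).
Local Notation integral := (@Defs.integral R).

(** Not the topological support: the segment may be larger than necessary, which leaves room
    wherever an argument needs the function to vanish at its ends. *)
Definition supp p q g := forall x, ~~ (p <= x <= q) -> g x = 0.

Definition intg g := mu.-integrable setT (EFin \o g).

Lemma supp_patch p q g : supp p q g -> g \_ `[p, q] = g.
Proof.
move=> sg; apply/funext => x; rewrite patchE; case: ifPn => // h.
by rewrite sg//; apply: contra h => ?; rewrite inE/= in_itv.
Qed.

Lemma continuous_supp_intg p q g : continuous g -> supp p q g -> intg g.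
Proof.
move=> cg sg; rewrite /intg -(supp_patch sg) -restrict_EFin.
apply/integrable_restrict => //=; rewrite setTI.
apply: continuous_compact_integrable.
  exact: segment_compact.
exact: continuous_subspaceT.
Qed.

Lemma integral_supp p q g : supp p q g ->
  integral g = \int[mu]_(x in `[p, q]) g x.
Proof. by move=> sg; rewrite Rintegral_mkcond (supp_patch sg). Qed.

Lemma supp_derive1 p q g : supp p q g -> supp p q (derive1 g).
Proof.
move=> sg x hx; rewrite derive1E.
rewrite (@near_eq_derive _ _ _ g (cst 0)) ?derive_cst//.
move: hx; rewrite negb_and -!ltNge => /orP[h|h].
  near=> z; apply: sg; rewrite negb_and -!ltNge; apply/orP; left.
  by near: z; exact: lt_nbhsl.
near=> z; apply: sg; rewrite negb_and -!ltNge; apply/orP; right.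
by near: z; exact: lt_nbhsr.
Unshelve. all: by end_near. Qed.

Lemma suppW p q p' q' g : p' <= p -> q <= q' -> supp p q g -> supp p' q' g.
Proof.
move=> pp qq sg x hx; apply: sg; apply: contra hx => /andP[h1 h2].
by rewrite (le_trans pp)// (le_trans h2).
Qed.

Lemma supp_mulr p q f g : supp p q f -> supp p q (fun x => f x * g x).
Proof. by move=> sf x hx; rewrite sf ?mul0r. Qed.

Lemma supp_add p q f g : supp p q f -> supp p q g -> supp p q (fun x => f x + g x).
Proof. by move=> sf sg x hx; rewrite sf ?sg ?addr0. Qed.

Lemma supp_sub p q f g : supp p q f -> supp p q g -> supp p q (fun x => f x - g x).
Proof. by move=> sf sg x hx; rewrite sf ?sg ?subr0. Qed.

Lemma supp_scale p q c f : supp p q f -> supp p q (fun x => c * f x).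
Proof. by move=> sf x hx; rewrite sf ?mulr0. Qed.

Lemma supp_bumpf c e : supp (c - e) (c + e) (bumpf c e).
Proof.
by move=> x hx; apply: bumpf_eq0; apply: contra hx => /andP[h1 h2]; rewrite !ltW.
Qed.

Lemma sm_supp_intg p q g : sm g -> supp p q g -> intg g.
Proof. by move=> /sm_continuous; exact: continuous_supp_intg. Qed.

Lemma integral_add f g : intg f -> intg g ->
  integral (fun x => f x + g x) = integral f + integral g.
Proof. by move=> hf hg; rewrite /Defs.integral RintegralD. Qed.

Lemma integral_sub f g : intg f -> intg g ->
  integral (fun x => f x - g x) = integral f - integral g.
Proof. by move=> hf hg; rewrite /Defs.integral RintegralB. Qed.

Lemma integral_scale c f : intg f -> integral (fun x => c * f x) = c * integral f.
Proof. by move=> hf; rewrite /Defs.integral RintegralZl. Qed.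

Lemma intgD f g : intg f -> intg g -> intg (fun x => f x + g x).
Proof.
move=> hf hg; have := integrableD measurableT hf hg.
by apply: eq_integrable => // x _; rewrite /= EFinD.
Qed.

Lemma intgZ c f : intg f -> intg (fun x => c * f x).
Proof.
move=> hf; have := integrableZl measurableT c hf.
by apply: eq_integrable => // x _; rewrite /= EFinM.
Qed.

Lemma intgB f g : intg f -> intg g -> intg (fun x => f x - g x).
Proof.
move=> hf hg; have := integrableB measurableT hf hg.
by apply: eq_integrable => // x _; rewrite /= EFinB.
Qed.

Lemma integral_le f g : intg f -> intg g -> (forall x, f x <= g x) ->
  integral f <= integral g.
Proof. by move=> hf hg fg; apply: le_Rintegral => // x _; exact: fg. Qed.

Lemma normr_integral_le f g : intg f -> intg g -> (forall x, `|f x| <= g x) ->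
  `|integral f| <= integral g.
Proof.
move=> hf hg fg; rewrite ler_norml; apply/andP; split.
  rewrite -mulN1r -integral_scale//; apply: integral_le => // [|x].
    exact: intgZ.
  by rewrite mulN1r; have := fg x; rewrite ler_norml => /andP[].
by apply: integral_le => // x; have := fg x; rewrite ler_norml => /andP[].
Qed.

Lemma integral_nonneg f : (forall x, 0 <= f x) -> 0 <= integral f.
Proof. by move=> f0; apply: Rintegral_ge0 => // x _; exact: f0. Qed.

Lemma Rintegral_FTC2 p q F f : p < q -> {within `[p, q], continuous f} ->
  (forall x, p <= x <= q -> is_derive x 1 F (f x)) ->
  \int[mu]_(x in `[p, q]) f x = F q - F p.
Proof.
move=> pq cf dF; rewrite /Rintegral (@continuous_FTC2 _ f F)//.
have cF x : p <= x <= q -> {for x, continuous F}.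
  move=> h; apply/differentiable_continuous/derivable1_diffP.
  by case: (dF x h).
- split => [x||].
  + by rewrite in_itv/= => /andP[h1 h2]; case: (dF x _) => //; rewrite !ltW.
  + by apply: cvg_at_right_filter; apply: cF; rewrite lexx ltW.
  + by apply: cvg_at_left_filter; apply: cF; rewrite lexx ltW.
- move=> x; rewrite in_itv/= => /andP[h1 h2]; rewrite derive1E.
  by apply: derive_val; apply: dF; rewrite !ltW.
Qed.

Lemma integral_derive1 p q g : p <= q -> sm g -> supp p q g ->
  integral (derive1 g) = 0.
Proof.
move=> pq sg hg.
(* [supp] says nothing at [p] and [q] themselves; on the enlarged segment [g] vanishes at both
   ends. *)
have pq' : p - 1 < q + 1 by lra.
have hg' : supp (p - 1) (q + 1) (derive1 g).
  by apply: (@suppW p q); [lra|lra|exact: supp_derive1].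
have cg : {within `[p - 1, q + 1], continuous (derive1 g)}.
  by apply: continuous_subspaceT; apply: sm_continuous; exact: sm_derive1.
have dg x : p - 1 <= x <= q + 1 -> is_derive x 1 g (derive1 g x).
  by move=> _; rewrite derive1E; apply: derivableP; exact: sm_derivable.
rewrite (integral_supp hg') (Rintegral_FTC2 pq' cg dg).
by rewrite !hg ?subrr//; rewrite negb_and -!ltNge; apply/orP; [left|right]; lra.
Qed.

Lemma integral_shift p q c g : p <= q -> continuous g -> supp p q g ->
  integral (fun t => g (t - c)) = integral g.
Proof.
move=> pq cg sg.
have sg' : supp (p + c) (q + c) (fun t => g (t - c)).
  move=> x hx; apply: sg; apply: contra hx => /andP[h1 h2].
  by apply/andP; split; lra.
rewrite (integral_supp sg) (integral_supp sg').
have dF (x : R) : is_derive x 1 (fun x : R => x - c) 1.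
  by have := is_deriveB (is_derive_id x 1) (is_derive_cst c x 1); rewrite subr0.
have dF1 : derive1 (fun x : R => x - c) = cst 1.
  by apply/funext => x; rewrite derive1E derive_val.
have cF (x : R) : {for x, continuous (fun x : R => x - c)}.
  by apply/differentiable_continuous/derivable1_diffP; case: (dF x).
have := @integration_by_substitution_increasing R (fun x => x - c) g (p + c) (q + c).
rewrite /Rintegral !addrK => ->; rewrite ?lerD2r//.
- by rewrite dF1; congr fine; apply: eq_integral => x _ /=; rewrite mulr1.
- by move=> x y _ _; rewrite ltrD2r.
- by rewrite dF1 => x _; exact: cvg_cst.
- by rewrite dF1; exact: is_cvg_cst.
- by rewrite dF1; exact: is_cvg_cst.
- split => [x _||]; first by case: (dF x).
    by apply: cvg_at_right_filter; exact: cF.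
  by apply: cvg_at_left_filter; exact: cF.
- exact: continuous_subspaceT.
Qed.

Lemma integral_pos p q g : p < q -> continuous g -> (forall x, 0 <= g x) ->
  supp p q g -> (forall x, p < x < q -> 0 < g x) -> 0 < integral g.
Proof.
move=> pq cg g0 sg gp.
(* On the middle third the continuous [g] has a positive minimum; at the ends of the full segment it
   may vanish. *)
pose a := (2 * p + q) / 3; pose b := (p + 2 * q) / 3.
have ab : a < b by rewrite /a /b; lra.
have [c + hc] := EVT_min (ltW ab) (continuous_subspaceT cg).
rewrite in_itv/= => /andP[ac cb].
have gc : 0 < g c by apply: gp; move: ac cb; rewrite /a /b => ? ?; apply/andP; split; lra.
have ig := continuous_supp_intg cg sg.
have iab : mu.-integrable `[a, b] (EFin \o g).
  by apply: integrableS ig.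
have icst : mu.-integrable `[a, b] (EFin \o fun=> g c).
  apply: continuous_compact_integrable; first exact: segment_compact.
  by apply: continuous_subspaceT => x; exact: cvg_cst.
apply: (@lt_le_trans _ _ (\int[mu]_(x in `[a, b]) g x)).
  apply: (@lt_le_trans _ _ (\int[mu]_(x in `[a, b]) g c)).
    have mab := lebesgue_measure_itv `[a, b].
    rewrite /= lte_fin ab -EFinB in mab.
    by rewrite Rintegral_cst// [X in fine X]mab/= mulr_gt0// subr_gt0.
  by apply: le_Rintegral => // x xab; apply: hc.
rewrite Rintegral_mkcond; apply: le_Rintegral => //.
  by rewrite -restrict_EFin; apply/integrable_restrict => //=; rewrite setTI.
by move=> x _; rewrite patchE; case: ifP.
Qed.

Lemma continuous_bounded p q g : {within `[p, q], continuous g} ->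
  exists2 C, 0 <= C & forall x, p <= x <= q -> `|g x| <= C.
Proof.
move=> cg; have [qp|pq] := ltP q p.
  by exists 0 => // x /andP[h1 h2]; lra.
have cn : {within `[p, q], continuous (fun x => `|g x|)}.
  by move=> x; apply: continuous_comp (cg x) _; exact: norm_continuous.
have [c _ hc] := EVT_max pq cn.
by exists `|g c| => // x hx; apply: hc; rewrite in_itv.
Qed.

End CompactSupport.

(** * Fourier coefficients: decay, and convergence of the series to 0 off the support *)

Section FourierCoefficients.
Variable R : realType.
Implicit Types (f g u v w F G : R -> R) (p q t x y : R) (k m j : int).
Local Notation mu := (@lebesgue_measure R).
Local Notation integral := (@Defs.integral R).
Local Notation pi := (@pi R).

(* For psi = u + i v, these are the real parts of the integrals of
   psi e^{2 pi i k t}; the imaginary parts are [coef v (- u) k]. *)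
Definition coef u v (k : int) : R :=
  integral (fun t => u t * cos (2 * pi * k%:~R * t) - v t * sin (2 * pi * k%:~R * t)).

Definition symsum (F : int -> R) (M : nat) : R :=
  F 0 + \sum_(i < M) (F i.+1%:Z + F (- i.+1%:Z)).

Definition rapid (c : int -> R) : Prop :=
  forall K : nat, exists C : R, forall k, `|c k| * (1 + `|k%:~R : R|) ^+ K <= C.

Lemma sm_cosM a : sm (fun t => cos (a * t) : R).
Proof.
rewrite (_ : (fun t => _) = (fun t => cos (a * t + 0))).
  by apply: sm_affine; exact: sm_cos.
by apply/funext => t; rewrite addr0.
Qed.

Lemma sm_sinM a : sm (fun t => sin (a * t) : R).
Proof.
rewrite (_ : (fun t => _) = (fun t => sin (a * t + 0))).
  by apply: sm_affine; exact: sm_sin.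
by apply/funext => t; rewrite addr0.
Qed.

Lemma is_derive_mulr a (x : R) : is_derive x 1 (fun t : R => a * t) a.
Proof. by have := is_deriveZ a (is_derive_id x 1); rewrite /GRing.scale/= mulr1. Qed.

Lemma is_derive_cosM a (x : R) : is_derive x 1 (fun t => cos (a * t) : R) (- a * sin (a * x)).
Proof.
have := is_derive1_comp (is_derive_cos (a * x)) (is_derive_mulr a x).
by rewrite mulrC mulrN -mulNr.
Qed.

Lemma is_derive_sinM a (x : R) : is_derive x 1 (fun t => sin (a * t) : R) (a * cos (a * x)).
Proof.
by have := is_derive1_comp (is_derive_sin (a * x)) (is_derive_mulr a x); rewrite mulrC.
Qed.

Lemma sm_is_derive1 u (x : R) : sm u -> is_derive x 1 u (derive1 u x).
Proof. by move=> su; rewrite derive1E; apply: derivableP; exact: sm_derivable. Qed.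

Lemma coef_intg p q u v k : sm u -> sm v -> supp p q u -> supp p q v ->
  intg (fun t => u t * cos (2 * pi * k%:~R * t) - v t * sin (2 * pi * k%:~R * t)).
Proof.
move=> su sv hu hv; apply: (@sm_supp_intg _ p q).
  by apply: sm_sub; apply: sm_mul => //; [exact: sm_cosM|exact: sm_sinM].
by apply: supp_sub; exact: supp_mulr.
Qed.

Lemma coef_linear p q a b u1 v1 u2 v2 k :
  sm u1 -> sm v1 -> supp p q u1 -> supp p q v1 ->
  sm u2 -> sm v2 -> supp p q u2 -> supp p q v2 ->
  coef (fun t => a * u1 t + b * u2 t) (fun t => a * v1 t + b * v2 t) k =
  a * coef u1 v1 k + b * coef u2 v2 k.
Proof.
move=> su1 sv1 hu1 hv1 su2 sv2 hu2 hv2.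
have i1 := coef_intg k su1 sv1 hu1 hv1; have i2 := coef_intg k su2 sv2 hu2 hv2.
rewrite /coef -(integral_scale a i1) -(integral_scale b i2).
rewrite -integral_add; [|exact: intgZ|exact: intgZ].
by congr Defs.integral; apply/funext => t; ring.
Qed.

(** Integration by parts: for psi = u + i v, the function (i / 2 pi) psi' has components -v' / 2 pi
    and u' / 2 pi. The auxiliary [G] is the imaginary part of psi e^{2 pi i k t}, and its derivative
    has integral 0. *)
Lemma coef_derive p q u v k : p <= q -> sm u -> sm v -> supp p q u -> supp p q v ->
  coef (fun t => - (2 * pi)^-1 * derive1 v t) (fun t => (2 * pi)^-1 * derive1 u t) k =
  k%:~R * coef u v k.
Proof.
move=> pq su sv hu hv.
have pi0 : pi != 0 by rewrite gt_eqF// pi_gt0.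
set a := 2 * pi * k%:~R.
pose G t := v t * cos (a * t) + u t * sin (a * t).
have sG : sm G.
  by apply: sm_add; apply: sm_mul => //; [exact: sm_cosM|exact: sm_sinM].
have hG : supp p q G by apply: supp_add; exact: supp_mulr.
have dG t : derive1 G t = derive1 v t * cos (a * t) + derive1 u t * sin (a * t) +
    a * (u t * cos (a * t) - v t * sin (a * t)).
  rewrite derive1E; have := is_deriveD (is_deriveM (sm_is_derive1 t sv) (is_derive_cosM a t))
      (is_deriveM (sm_is_derive1 t su) (is_derive_sinM a t)).
  by case=> _ ->; rewrite /GRing.scale/=; ring.
rewrite /coef -(integral_scale _ (coef_intg _ su sv hu hv)).
rewrite -[RHS]add0r -(mulr0 (- (2 * pi)^-1)) -(integral_derive1 pq sG hG).
rewrite -integral_scale; last first.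
  by apply: (@sm_supp_intg _ p q); [exact: sm_derive1|exact: supp_derive1].
rewrite -integral_add; first last.
- exact/intgZ/(coef_intg _ su sv hu hv).
- apply: intgZ; apply: (@sm_supp_intg _ p q); [exact: sm_derive1|exact: supp_derive1].
congr Defs.integral; apply/funext => t; rewrite dG -/a.
have -> : k%:~R = (2 * pi)^-1 * a by rewrite /a mulrA mulVf ?mul1r// mulf_neq0// pnatr_eq0.
ring.
Qed.

Lemma coef_bounded p q u v : sm u -> sm v -> supp p q u -> supp p q v ->
  exists C, forall k, `|coef u v k| <= C.
Proof.
move=> su sv hu hv; exists (integral (fun t => `|u t| + `|v t|)) => k.
apply: normr_integral_le; first exact: coef_intg hu hv.
  apply: (@continuous_supp_intg _ p q).
    move=> x; apply: cvgD; apply: cvg_norm; exact: sm_continuous.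
  by move=> x hx; rewrite hu// hv// normr0 addr0.
move=> t; apply: le_trans (ler_normB _ _) _; rewrite !normrM.
have c1 : `|cos (2 * pi * k%:~R * t)| <= 1 by rewrite ler_norml cos_geN1 cos_le1.
have s1 : `|sin (2 * pi * k%:~R * t)| <= 1 by rewrite ler_norml sin_geN1 sin_le1.
by apply: lerD; apply: ler_piMr.
Qed.

(** Each use of [coef_derive] trades a factor k for a derivative of psi, whose coefficients are
    again bounded. *)
Lemma coef_decay p q (K : nat) u v : p <= q -> sm u -> sm v -> supp p q u -> supp p q v ->
  exists C, forall k, `|coef u v k| * `|k%:~R : R| ^+ K <= C.
Proof.
move=> pq; elim: K u v => [|K IH] u v su sv hu hv.
  have [C hC] := coef_bounded su sv hu hv.
  by exists C => k; rewrite expr0 mulr1.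
have [||||C hC] := IH (fun t => - (2 * pi)^-1 * derive1 v t)
  (fun t => (2 * pi)^-1 * derive1 u t).
- exact/sm_scale/sm_derive1.
- exact/sm_scale/sm_derive1.
- exact/supp_scale/supp_derive1.
- exact/supp_scale/supp_derive1.
exists C => k; apply: le_trans (hC k).
by rewrite (coef_derive k pq su sv hu hv) normrM exprS mulrA [X in X * _]mulrC.
Qed.

Lemma coef_rapid p q u v : p <= q -> sm u -> sm v -> supp p q u -> supp p q v ->
  rapid (coef u v).
Proof.
move=> pq su sv hu hv K.
have [C0 h0] := coef_bounded su sv hu hv.
have [C1 h1] := coef_decay K pq su sv hu hv.
exists (2 ^+ K * (C0 + C1)) => k.
set a : R := `|k%:~R|; have a0 : 0 <= a by rewrite /a.
have hK : (1 + a) ^+ K <= 2 ^+ K * (1 + a ^+ K).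
  have [a1|a1] := leP a 1.
    apply: (@le_trans _ _ (2 ^+ K)).
      by apply: lerXn2r; rewrite ?nnegrE//; lra.
    by rewrite ler_peMr ?exprn_ge0// lerDl exprn_ge0.
  apply: (@le_trans _ _ ((2 * a) ^+ K)).
    by apply: lerXn2r; rewrite ?nnegrE//; lra.
  by rewrite exprMn ler_wpM2l ?exprn_ge0// lerDr.
apply: le_trans (ler_wpM2l (normr_ge0 _) hK) _.
rewrite mulrCA ler_wpM2l ?exprn_ge0// mulrDr mulr1.
by apply: lerD; [exact: h0|exact: h1].
Qed.

(** The Dirichlet kernel, that is the sum of e^{2 pi i k s} over |k| <= M with k and -k paired. *)
Definition dirichlet (M : nat) (s : R) : R :=
  1 + \sum_(i < M) 2 * cos (2 * pi * i.+1%:R * s).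

(** Telescoping of 2 sin(pi s) cos(2 pi j s) = sin((2j+1) pi s) - sin((2j-1) pi s). The product form
    holds also where sin(pi s) = 0. *)
Lemma dirichletE M s : sin (pi * s) * dirichlet M s = sin ((2 * M + 1)%:R * pi * s).
Proof.
elim: M => [|M IH]; first by rewrite /dirichlet big_ord0 addr0 mulr1 muln0 add0n mul1r.
rewrite /dirichlet big_ord_recr/= addrA mulrDr -/(dirichlet M s) IH.
set y := 2 * pi * M.+1%:R * s.
have -> : (2 * M + 1)%:R * pi * s = y - pi * s.
  by rewrite /y natrD natrM -natr1; ring.
have -> : (2 * M.+1 + 1)%:R * pi * s = y + pi * s.
  by rewrite /y natrD natrM -natr1; ring.
by rewrite sinB sinD; ring.
Qed.

Lemma sm_dirichlet M (x : R) : sm (fun t => dirichlet M (t - x)).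
Proof.
rewrite /dirichlet; elim: M => [|M IH].
  rewrite (_ : (fun t => _) = (fun=> 1)); first exact: sm_cst.
  by apply/funext => t; rewrite big_ord0 addr0.
rewrite (_ : (fun t => _) = (fun t => (1 + \sum_(i < M) 2 * cos (2 * pi * i.+1%:R * (t - x))) +
   2 * cos (2 * pi * M.+1%:R * t + - (2 * pi * M.+1%:R * x)))); last first.
  by apply/funext => t; rewrite big_ord_recr/= addrA mulrBr.
by apply: sm_add => //; apply: sm_scale; apply: sm_affine; exact: sm_cos.
Qed.

(** The summand is the real part of c_k e^{-2 pi i k x}, i.e. of the integral of psi e^{2 pi i k (t
    - x)}. Adding k and -k cancels the sines, so [v] drops out. *)
Lemma symsum_coef p q u v M (x : R) : sm u -> sm v -> supp p q u -> supp p q v ->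
  symsum (fun k => coef u v k * cos (2 * pi * k%:~R * x) +
                   coef v (fun t => - u t) k * sin (2 * pi * k%:~R * x)) M =
  integral (fun t => u t * dirichlet M (t - x)).
Proof.
move=> su sv hu hv.
have hNu : supp p q (fun t => - u t) by move=> t ht; rewrite hu ?oppr0.
set F := fun k : int => _.
have FE k : F k = integral (fun t => u t * cos (2 * pi * k%:~R * (t - x)) -
                                     v t * sin (2 * pi * k%:~R * (t - x))).
  rewrite /F ![_ * cos _]mulrC ![_ * sin _]mulrC /coef -integral_scale; last first.
    exact: coef_intg hu hv.
  rewrite -integral_scale; last exact: (coef_intg _ sv (sm_opp su) hv hNu).
  rewrite -integral_add; first last.
  - exact/intgZ/(coef_intg _ sv (sm_opp su) hv hNu).
  - exact/intgZ/(coef_intg _ su sv hu hv).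
  congr Defs.integral; apply/funext => t.
  by rewrite (mulrBr (2 * pi * k%:~R)) cosB sinB; ring.
have iF k : intg (fun t => u t * cos (2 * pi * k%:~R * (t - x)) -
                           v t * sin (2 * pi * k%:~R * (t - x))).
  apply: (@sm_supp_intg _ p q).
    rewrite (_ : (fun t => _) =
        (fun t => u t * cos (2 * pi * k%:~R * t + - (2 * pi * k%:~R * x)) -
                  v t * sin (2 * pi * k%:~R * t + - (2 * pi * k%:~R * x)))).
      apply: sm_sub; apply: sm_mul => //; apply: sm_affine; [exact: sm_cos|exact: sm_sin].
    by apply/funext => t; rewrite mulrBr.
  by apply: supp_sub; exact: supp_mulr.
elim: M => [|M IH].
  rewrite /symsum big_ord0 addr0 FE; congr Defs.integral; apply/funext => t.
  by rewrite mulr0z mulr0 !mul0r cos0 sin0 mulr0 subr0 /dirichlet big_ord0 addr0.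
have -> : symsum F M.+1 = symsum F M + (F M.+1%:Z + F (- M.+1%:Z)).
  by rewrite /symsum big_ord_recr addrA.
rewrite IH !FE -integral_add; [|exact: iF|exact: iF].
rewrite -integral_add; first last.
- by apply: intgD; exact: iF.
- apply: (@sm_supp_intg _ p q); last exact: supp_mulr.
  by apply: sm_mul => //; exact: sm_dirichlet.
congr Defs.integral; apply/funext => t.
rewrite /dirichlet big_ord_recr/= mulrNz !mulrN !mulNr cosN sinN -pmulrn; ring.
Qed.

(** Riemann-Lebesgue with a rate. Where sin(pi (t - x)) has no zero, dividing [u] by it gives a
    differentiable [w]; the integrand becomes [w] times sin((2M+1) pi (t - x)), and one integration
    by parts gains a factor of order 1/M. *)
Lemma symsum_coef_cvg0 p q p' q' u v (x : R) : p < p' -> p' <= q' -> q' < q ->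
  sm u -> sm v -> supp p' q' u -> supp p' q' v ->
  (forall t, p <= t <= q -> sin (pi * (t - x)) != 0) ->
  symsum (fun k => coef u v k * cos (2 * pi * k%:~R * x) +
                   coef v (fun t => - u t) k * sin (2 * pi * k%:~R * x)) M
    @[M --> \oo] --> (0 : R).
Proof.
move=> pp' pq' qq' su sv hu hv hsin.
have pq : p < q by lra.
pose s t := sin (pi * (t - x)); pose c t := cos (pi * (t - x)).
pose w t := u t / s t.
pose w' t := (derive1 u t * s t - u t * (pi * c t)) / s t ^+ 2.
have ss : sm s.
  rewrite /s (_ : (fun t => _) = (fun t => sin (pi * t + - (pi * x)))).
    by apply: sm_affine; exact: sm_sin.
  by apply/funext => t; rewrite mulrBr.
have sc : sm c.
  rewrite /c (_ : (fun t => _) = (fun t => cos (pi * t + - (pi * x)))).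
    by apply: sm_affine; exact: sm_cos.
  by apply/funext => t; rewrite mulrBr.
have dsh (a t : R) : is_derive t 1 (fun t => a * (t - x)) a.
  have := is_deriveZ a (is_deriveB (is_derive_id t 1) (is_derive_cst x t 1)).
  by rewrite subr0 /GRing.scale/= mulr1.
have ds t : is_derive t 1 s (c t * pi).
  exact: (@is_derive1_comp R sin (fun t => pi * (t - x)) t _ _ (is_derive_sin _) (dsh pi t)).
have cw' : {within `[p, q], continuous w'}.
  have c1 : continuous (fun t => derive1 u t * s t - u t * (pi * c t)).
    apply: sm_continuous; apply: sm_sub; apply: sm_mul => //.
      exact: sm_derive1.
    exact: sm_scale.
  have c2 : continuous (fun t => s t ^+ 2).
    by apply: (@sm_continuous _ (fun t => s t * s t)); exact: sm_mul.
  apply: continuous_in_subspaceT => t; rewrite inE/= in_itv/= => ht.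
  apply: cvgM; first exact: c1.
  by apply: cvgV; [rewrite expf_neq0// hsin|exact: c2].
have [C C0 hC] := continuous_bounded cw'.
have key M : `|integral (fun t => u t * dirichlet M (t - x))| <=
    C * (q - p) / ((2 * M + 1)%:R * pi).
  set a := (2 * M + 1)%:R * pi.
  have a0 : 0 < a by rewrite mulr_gt0 ?pi_gt0// ltr0n addn1.
  pose cc t := cos (a * (t - x)).
  have scc : sm cc.
    rewrite /cc (_ : (fun t => _) = (fun t => cos (a * t + - (a * x)))).
      by apply: sm_affine; exact: sm_cos.
    by apply/funext => t; rewrite mulrBr.
  have dcc t : is_derive t 1 cc (- sin (a * (t - x)) * a).
    exact: (@is_derive1_comp R cos (fun t => a * (t - x)) t _ _ (is_derive_cos _) (dsh a t)).
  pose D t := u t * dirichlet M (t - x).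
  have sD : sm D by apply: sm_mul => //; exact: sm_dirichlet.
  have hD : supp p q D.
    by apply: supp_mulr; apply: suppW hu; lra.
  have cwc : {within `[p, q], continuous (fun t => w' t * cc t)}.
    by move=> t; apply: cvgM; [exact: cw'|exact: (continuous_subspaceT (sm_continuous scc))].
  have cD : {within `[p, q], continuous (fun t => a * D t)}.
    by apply: continuous_subspaceT; apply: sm_continuous; exact: sm_scale.
  have iwc : mu.-integrable `[p, q] (EFin \o (fun t => w' t * cc t)).
    by apply: continuous_compact_integrable => //; exact: segment_compact.
  have iD : mu.-integrable `[p, q] (EFin \o (fun t => a * D t)).
    by apply: continuous_compact_integrable => //; exact: segment_compact.
  have cf : {within `[p, q], continuous (fun t => w' t * cc t - a * D t)}.
    by move=> t; apply: cvgB; [exact: cwc|exact: cD].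
  (* The derivative of [w] [cc] contains -a [D]. As [w] [cc] vanishes at [p] and [q], which lie
     strictly outside [p', q'], the integral of a [D] equals that of [w'] [cc], which is bounded
     independently of [M]. *)
  have df t : p <= t <= q -> is_derive t 1 (fun t => w t * cc t) (w' t * cc t - a * D t).
    move=> ht; have st0 : s t != 0 := hsin _ ht.
    have dV := @is_deriveV R s t (c t * pi) 1 st0 (ds t).
    have := is_deriveM (is_deriveM (sm_is_derive1 t su) dV) (dcc t).
    move=> H; apply: is_derive_eq H _; rewrite /GRing.scale/=.
    rewrite /D /a -dirichletE.
    rewrite -/(s t); move: (dirichlet M (t - x)) => d.
    rewrite [X in X * (- _ * _)](_ : _ = u t / s t)// /w'.
    by field.
  have := Rintegral_FTC2 pq cf df.
  have u0 t : ~~ (p' <= t <= q') -> w t * cc t = 0.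
    by move=> ht; rewrite /w hu// !mul0r.
  rewrite !u0 ?subrr; first last.
  - by rewrite negb_and -!ltNge qq' orbT.
  - by rewrite negb_and -!ltNge pp'.
  rewrite RintegralB// => /subr0_eq E.
  have iD' : mu.-integrable `[p, q] (EFin \o D).
    apply: continuous_compact_integrable; first exact: segment_compact.
    exact: continuous_subspaceT (sm_continuous sD).
  rewrite RintegralZl// -(integral_supp hD) in E.
  rewrite ler_pdivlMr// mulrC -{1}(gtr0_norm a0) -normrM -E.
  apply: le_trans (le_normr_Rintegral _ _) _ => //.
  have icst : mu.-integrable `[p, q] (EFin \o fun=> C).
    apply: continuous_compact_integrable; first exact: segment_compact.
    by apply: continuous_subspaceT => t; exact: cvg_cst.
  have mpq := lebesgue_measure_itv `[p, q].
  rewrite /= lte_fin pq -EFinB in mpq.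
  have -> : C * (q - p) = \int[mu]_(t in `[p, q]) C.
    by rewrite Rintegral_cst// [X in fine X]mpq.
  apply: le_Rintegral => //; first exact: integrable_norm.
  move=> t /=; rewrite in_itv/= => ht; rewrite normrM.
  apply: le_trans (ler_piMr (normr_ge0 _) _) (hC t ht).
  by rewrite ler_norml cos_geN1 cos_le1.
under eq_fun do rewrite (symsum_coef _ _ su sv hu hv).
apply/cvgrPdist_le => e e0; near=> M; rewrite sub0r normrN.
apply: le_trans (key M) _.
have M1 : C * (q - p) / (e * pi) <= M%:R by near: M; exact: nbhs_infty_ger.
have hp : 0 < e * pi by rewrite mulr_gt0 ?pi_gt0.
rewrite ler_pdivrMr; last by rewrite mulr_gt0 ?pi_gt0// ltr0n addn1.
move: M1; rewrite ler_pdivrMr// => M1; apply: le_trans M1 _.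
rewrite mulrCA ler_wpM2l ?(ltW e0)// ler_wpM2r ?pi_ge0//.
by rewrite natrD natrM; have := ler0n R M; lra.
Unshelve. all: by end_near. Qed.

End FourierCoefficients.

(** * Sequences with a spectral gap and prescribed values at finitely many indices *)

Section GapSequences.
Variable R : realType.
Implicit Types (f g u v w F G : R -> R) (p q t x y : R) (k m j : int).
Local Notation integral := (@Defs.integral R).
Local Notation pi := (@pi R).

(** The start is a bump of mass 1 times e^{-2 pi i m t}. Every further step only multiplies the
    coefficients, so earlier zeros persist, and differentiation does not enlarge the support, so psi
    stays in the given segment. *)
Lemma coef_delta p q m (s : seq int) : p < q -> m \notin s ->
  exists u v, [/\ sm u, sm v, supp p q u & supp p q v] /\
    [/\ coef u v m = 1, coef v (fun t => - u t) m = 0,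
     forall k, k \in s -> coef u v k = 0 &
     forall k, k \in s -> coef v (fun t => - u t) k = 0].
Proof.
move=> pq; elim: s => [_|j s IH].
  pose B : R -> R := bumpf ((p + q) / 2) ((q - p) / 2).
  have hB : supp p q B.
    have := @supp_bumpf R ((p + q) / 2) ((q - p) / 2).
    by apply: suppW; lra.
  have sB : sm B := sm_bumpf _ _.
  have I0 : 0 < integral B.
    apply: (integral_pos pq (sm_continuous sB)) => // [t|t /andP[h1 h2]].
      exact: bumpf_ge0.
    by apply: bumpf_gt0; apply/andP; split; lra.
  set I := integral B in I0; pose a := 2 * pi * m%:~R.
  exists (fun t => I^-1 * (B t * cos (a * t))), (fun t => - (I^-1 * (B t * sin (a * t)))).
  split; [split|split => //].
  - by apply: sm_scale; apply: sm_mul => //; exact: sm_cosM.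
  - by apply: sm_opp; apply: sm_scale; apply: sm_mul => //; exact: sm_sinM.
  - by apply: supp_scale; exact: supp_mulr.
  - by move=> t ht; rewrite hB// mul0r mulr0 oppr0.
  - rewrite /coef -/a (_ : (fun t => _) = (fun t => I^-1 * B t)).
      by rewrite integral_scale ?mulVf ?gt_eqF//; apply: sm_supp_intg hB.
    apply/funext => t; transitivity (I^-1 * B t * (cos (a * t) ^+ 2 + sin (a * t) ^+ 2)).
      by ring.
    by rewrite cos2Dsin2 mulr1.
  - rewrite /coef -/a (_ : (fun t => _) = (fun t => 0 * B t)).
      by rewrite integral_scale ?mul0r//; apply: sm_supp_intg hB.
    by apply/funext => t; ring.
rewrite inE negb_or => /andP[mj ms].
have [u [v [[su sv hu hv] [cm sm0 c0 s0]]]] := IH ms.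
have suN := sm_opp su; have hNu : supp p q (fun t => - u t).
  by move=> t ht; rewrite hu ?oppr0.
have mj0 : (m - j)%:~R != 0 :> R by rewrite intr_eq0 subr_eq0.
pose a : R := (m - j)%:~R^-1; pose b := - j%:~R * a.
pose u' t := a * (- (2 * pi)^-1 * derive1 v t) + b * u t.
pose v' t := a * ((2 * pi)^-1 * derive1 u t) + b * v t.
have cu k : coef u' v' k = (k%:~R - j%:~R) * a * coef u v k.
  rewrite (@coef_linear _ p q)//; try (by apply: sm_scale; exact: sm_derive1);
    try (by apply: supp_scale; exact: supp_derive1).
  rewrite (coef_derive k (ltW pq) su sv hu hv) /b; ring.
have u'N : (fun t => - u' t) = (fun t => a * ((2 * pi)^-1 * derive1 v t) + b * - u t).
  by apply/funext => t; rewrite /u'; ring.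
(* The pair (v, -u) stands for -i psi, whose real coefficients are the imaginary ones of psi.
   Written this way, the operator acts on it as on psi and [coef_derive] applies. *)
have du : (fun t => (2 * pi)^-1 * derive1 u t) =
          (fun t => - (2 * pi)^-1 * derive1 (fun t => - u t) t).
  apply/funext => t; rewrite [X in _ = _ * X](_ : _ = - derive1 u t) ?mulrNN//.
  by rewrite !derive1E; have [_ ->] := is_deriveN (sm_is_derive1 t su); rewrite derive1E.
have cv k : coef v' (fun t => - u' t) k = (k%:~R - j%:~R) * a * coef v (fun t => - u t) k.
  rewrite u'N (@coef_linear _ p q)//; try (by apply: sm_scale; exact: sm_derive1);
    try (by apply: supp_scale; exact: supp_derive1).
  rewrite du (coef_derive k (ltW pq) sv suN hv hNu) /b; ring.
exists u', v'; split; [split|split].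
- by apply: sm_add; apply: sm_scale => //; apply: sm_scale; exact: sm_derive1.
- by apply: sm_add; apply: sm_scale => //; apply: sm_scale; exact: sm_derive1.
- by apply: supp_add; apply: supp_scale => //; apply: supp_scale; exact: supp_derive1.
- by apply: supp_add; apply: supp_scale => //; apply: supp_scale; exact: supp_derive1.
- by rewrite cu cm mulr1 -intrB /a mulfV.
- by rewrite cv sm0 mulr0.
- move=> k; rewrite inE cu => /orP[/eqP->|/c0->]; last by rewrite mulr0.
  by rewrite subrr !mul0r.
- move=> k; rewrite inE cv => /orP[/eqP->|/s0->]; last by rewrite mulr0.
  by rewrite subrr !mul0r.
Qed.

Lemma sin_pi_nat (n : nat) : sin (pi * n%:R) = 0.
Proof.
elim: n => [|n IH]; first by rewrite mulr0 sin0.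
by rewrite -natr1 mulrDr mulr1 sinDpi IH oppr0.
Qed.

Lemma sin_pi_int k : sin (pi * k%:~R) = 0.
Proof.
case: k => n; first by rewrite -pmulrn sin_pi_nat.
by rewrite NegzE mulrNz mulrN sinN -pmulrn sin_pi_nat oppr0.
Qed.

Lemma sin_pi_neq0 k y : -1 < y + k%:~R < 0 -> sin (pi * y) != 0.
Proof.
move=> /andP[h1 h2]; apply/eqP => s0.
have : sin (pi * (y + k%:~R)) = 0.
  by rewrite mulrDr sinD s0 sin_pi_int mul0r mulr0 addr0.
have : 0 < sin (- (pi * (y + k%:~R))).
  have pi0 := pi_gt0 R.
  by apply: sin_gt0_pi; apply/andP; split; nra.
by rewrite sinN => + E; rewrite E oppr0 ltxx.
Qed.

(** The two limits are the real and imaginary parts of the series of c_k e^{-2 pi i k x} with c =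
    [c1] + i [c2]; the sign matches the Fourier transform of a translate by k. *)
Definition gap_seq (S : set R) (c1 c2 : int -> R) : Prop :=
  [/\ rapid c1, rapid c2 & exists U : set R, [/\ open U, S `<=` U &
    forall x, U x ->
      symsum (fun k => c1 k * cos (2 * pi * k%:~R * x) +
                       c2 k * sin (2 * pi * k%:~R * x)) M @[M --> \oo] --> (0 : R) /\
      symsum (fun k => c2 k * cos (2 * pi * k%:~R * x) -
                       c1 k * sin (2 * pi * k%:~R * x)) M @[M --> \oo] --> (0 : R)]].

Lemma exists_gap_seq (d : R) m (s : seq int) : 0 < d < 1 -> m \notin s ->
  exists c1 c2, [/\ gap_seq (S_delta d) c1 c2, c1 m = 1, c2 m = 0 &
    forall k, k \in s -> c1 k = 0 /\ c2 k = 0].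
Proof.
move=> /andP[d0 d1] ms.
(* Modulo 1 the gap is (-d, 0). Its middle quarter supports psi, its middle half is the segment for
   the integration by parts, and the neighbourhood of [S_delta] chosen below is the complement of
   that middle half. *)
have pq : - (5 / 8 * d) < - (3 / 8 * d) by lra.
have [u [v [[su sv hu hv] [cm sm0 c0 s0]]]] := coef_delta pq ms.
have suN := sm_opp su; have hNu : supp (- (5 / 8 * d)) (- (3 / 8 * d)) (fun t => - u t).
  by move=> t ht; rewrite hu ?oppr0.
exists (coef u v), (coef v (fun t => - u t)); split => //; last first.
  by move=> k ks; rewrite c0// s0.
split.
- exact: (coef_rapid (ltW pq) su sv hu hv).
- exact: (coef_rapid (ltW pq) sv suN hv hNu).
exists (\bigcup_(k in [set: int]) `](k%:~R - d / 4)%R, (k%:~R + 1 - 3 / 4 * d)%R[%classic); split.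
- by apply: bigcup_open => k _; exact: interval_open.
- move=> x [k /andP[h1 h2]]; exists k => //=; rewrite in_itv/=.
  by apply/andP; split; lra.
move=> x [k _ /=]; rewrite in_itv/= => /andP[h1 h2].
have hs t : - (3 / 4 * d) <= t <= - (1 / 4 * d) -> sin (pi * (t - x)) != 0.
  move=> /andP[h3 h4]; apply: (@sin_pi_neq0 k).
  by apply/andP; split; lra.
have l1 : - (3 / 4 * d) < - (5 / 8 * d) by lra.
have l2 : - (3 / 8 * d) < - (1 / 4 * d) by lra.
split; first exact: symsum_coef_cvg0 l1 (ltW pq) l2 su sv hu hv hs.
have := symsum_coef_cvg0 l1 (ltW pq) l2 sv suN hv hNu hs.
rewrite [X in X @ _ --> _ -> _](_ : _ = symsum (fun k => coef v (fun t => - u t) k * cos (2 * pi * k%:~R * x) -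
                       coef u v k * sin (2 * pi * k%:~R * x)))//.
apply/funext => M; congr symsum; apply/funext => n.
rewrite -mulNr; congr (_ + _ * _).
rewrite /coef -mulN1r -integral_scale; last exact: coef_intg hu hv.
by congr Defs.integral; apply/funext => t; ring.
Qed.

End GapSequences.

(** * Periodized bumps as Schwartz functions *)

Section Periodization.
Variable R : realType.
Implicit Types (f g u v w F G : R -> R) (p q t x y z : R) (k m j n : int) (c : int -> R).
Local Notation mu := (@lebesgue_measure R).
Local Notation integral := (@Defs.integral R).

(** The n with t - n in [z - 1/2, z + 1/2), hence the only one for which [u] (t - n) can be
    nonzero. *)
Definition cell z t : int := Num.floor (t - z + 2^-1).

(* The sum over n of [c n * u (t - n)], as at most one term is nonzero when
   [u] is supported in [z - 1/4, z + 1/4]. *)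
Definition per z c u t : R := c (cell z t) * u (t - (cell z t)%:~R).

Lemma cellP z t : (cell z t)%:~R <= t - z + 2^-1 < (cell z t)%:~R + 1.
Proof. by have := floor_itv (t - z + 2^-1); rewrite intrD. Qed.

Lemma int_cases n m : [\/ n = m, n%:~R + 1 <= m%:~R :> R | m%:~R + 1 <= n%:~R :> R].
Proof.
have [h|h|->] := ltgtP n m; last by constructor 1.
- by constructor 2; rewrite -[1]/(1%:~R) -intrD ler_int -ltzD1 ltrD2r.
- by constructor 3; rewrite -[1]/(1%:~R) -intrD ler_int -ltzD1 ltrD2r.
Qed.

Lemma notin_supp z x : x < z - 4^-1 \/ z + 4^-1 < x -> ~~ (z - 4^-1 <= x <= z + 4^-1).
Proof. by rewrite negb_and -!ltNge => -[->|->]//; rewrite orbT. Qed.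

(** If x lies in another cell than t, both sides are 0: the support of [u] fills only the middle
    half of a cell and keeps a distance 1/4 from its ends. So [per] is locally one translate of [u],
    and it may be differentiated termwise. *)
Lemma per_local z c u t x : supp (z - 4^-1) (z + 4^-1) u -> `|x - t| < 4^-1 ->
  per z c u x = c (cell z t) * u (x - (cell z t)%:~R).
Proof.
move=> hu; rewrite ltr_norml => /andP[h1 h2]; rewrite /per.
have /andP[h3 h4] := cellP z t; have /andP[h5 h6] := cellP z x.
have [->//|h|h] := int_cases (cell z x) (cell z t).
- by rewrite !hu ?mulr0//; apply: notin_supp; [left|right]; lra.
- by rewrite !hu ?mulr0//; apply: notin_supp; [right|left]; lra.
Qed.

Lemma u_other_cell z u t n : supp (z - 4^-1) (z + 4^-1) u -> n != cell z t ->
  u (t - n%:~R) = 0.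
Proof.
move=> hu; have /andP[h3 h4] := cellP z t.
have [->|h|h] := int_cases n (cell z t); first by rewrite eqxx.
- by move=> _; apply: hu; apply: notin_supp; right; lra.
- by move=> _; apply: hu; apply: notin_supp; left; lra.
Qed.

Lemma is_derive_per z c u t : sm u -> supp (z - 4^-1) (z + 4^-1) u ->
  is_derive t 1 (per z c u) (per z c (derive1 u) t).
Proof.
move=> su hu.
have d1 : is_derive t 1 (fun x : R => x - (cell z t)%:~R) 1.
  by have := is_deriveB (is_derive_id t 1) (is_derive_cst ((cell z t)%:~R : R) t 1); rewrite subr0.
have d2 := @is_derive1_comp R u (fun x : R => x - (cell z t)%:~R) t _ _
  (sm_is_derive1 (t - (cell z t)%:~R) su) d1.
have := is_deriveZ (c (cell z t)) d2; rewrite mulr1 => d3.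
apply: (near_eq_is_derive _ d3).
apply/nbhs_ballP; exists 4^-1 => [|x]; first by rewrite /= invr_gt0.
by rewrite /ball/= distrC => xt; apply/esym/per_local.
Qed.

Lemma derive1n_per z c u l : sm u -> supp (z - 4^-1) (z + 4^-1) u ->
  derive1n l (per z c u) = per z c (derive1n l u).
Proof.
move=> su hu; elim: l u su hu => [//|l IH] u su hu.
rewrite !derive1Sn -IH; [|exact: sm_derive1|exact: supp_derive1].
congr derive1n; apply/funext => t; rewrite derive1E.
by case: (is_derive_per c t su hu).
Qed.

Lemma supp_derive1n p q u l : supp p q u -> supp p q (derive1n l u).
Proof. by move=> hu; elim: l => // l; rewrite derive1nS; exact: supp_derive1. Qed.

Lemma continuous_per z c u : sm u -> supp (z - 4^-1) (z + 4^-1) u -> continuous (per z c u).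
Proof.
move=> su hu t; apply/differentiable_continuous/derivable1_diffP.
by case: (is_derive_per c t su hu).
Qed.

(** Converts decay of the coefficients in their index into decay of [per] in t. *)
Lemma norm_cell z t : 1 + `|t| <= (1 + `|(cell z t)%:~R|) * (2 + `|z|).
Proof.
have /andP[h3 h4] := cellP z t.
have ht : `|t| <= `|(cell z t)%:~R| + `|z| + 1.
  have : `|t| <= `|(cell z t)%:~R + z| + 1.
    rewrite -[in leLHS](subrK ((cell z t)%:~R + z) t) addrC.
    apply: le_trans (ler_normD _ _) _; rewrite lerD2l ler_norml.
    by apply/andP; split; lra.
  by move/le_trans; apply; rewrite lerD2r ler_normD.
have := normr_ge0 ((cell z t)%:~R : R); have := normr_ge0 z; nra.
Qed.

Lemma per_decay z c u (K : nat) : rapid c -> sm u -> supp (z - 4^-1) (z + 4^-1) u ->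
  exists2 C, 0 <= C & forall t, `|per z c u t| * (1 + `|t|) ^+ K <= C.
Proof.
move=> rc su hu; have [C hC] := rc K.
have [B B0 hB] := continuous_bounded (continuous_subspaceT (sm_continuous su)
  : {within `[z - 4^-1, z + 4^-1], continuous u}).
have hB' t : `|u t| <= B.
  by have [/hB//|h] := boolP (z - 4^-1 <= t <= z + 4^-1); rewrite hu ?normr0.
have C0 : 0 <= C by apply: le_trans (hC 0); rewrite mulr_ge0// exprn_ge0// addr_ge0.
exists (B * (2 + `|z|) ^+ K * C) => [|t].
  by rewrite !mulr_ge0// exprn_ge0// addr_ge0.
rewrite /per normrM; set n := cell z t.
apply: (@le_trans _ _ (`|c n| * B * ((1 + `|n%:~R|) * (2 + `|z|)) ^+ K)).
  apply: ler_pM; rewrite ?mulr_ge0 ?exprn_ge0 ?addr_ge0//.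
    by rewrite ler_wpM2l.
  by apply: lerXn2r; rewrite ?nnegrE ?mulr_ge0 ?addr_ge0//; exact: norm_cell.
rewrite exprMn mulrACA mulrC.
by rewrite ler_wpM2l// mulr_ge0// exprn_ge0// addr_ge0.
Qed.

Lemma schwartzR_per z c u : rapid c -> sm u -> supp (z - 4^-1) (z + 4^-1) u ->
  schwartzR (per z c u).
Proof.
move=> rc su hu; split=> [l t|K l].
  rewrite derive1n_per//.
  by case: (is_derive_per c t (sm_derive1n l su) (supp_derive1n l hu)).
have [C C0 hC] := per_decay K rc (sm_derive1n l su) (supp_derive1n l hu).
exists C => t; rewrite derive1n_per//; apply: le_trans (hC t).
rewrite normrM mulrC ler_wpM2l// normrX.
by apply: lerXn2r; rewrite ?nnegrE ?addr_ge0// lerDr.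
Qed.

Lemma intg_oneDsqrV : intg (fun t : R => (oneDsqr t)^-1).
Proof.
have mf : measurable_fun [set: R] (fun t : R => (oneDsqr t)^-1).
  by apply: continuous_measurable_fun; exact: continuous_oneDsqrV.
apply/integrableP; split; first exact/measurable_EFinP.
under eq_integral => t _ do rewrite /= ger0_norm ?invr_ge0 ?(le_trans ler01)//.
rewrite (@ge0_symfun_integralT _ (fun t : R => (oneDsqr t)^-1)); first last.
- by move=> t /=; rewrite /oneDsqr sqrrN.
- exact: continuous_oneDsqrV.
- by move=> t; rewrite invr_ge0 (le_trans ler01).
by rewrite -set_itvcy integral0y_oneDsqr -EFinM ltry.
Qed.

Lemma intg_decay G C : continuous G -> (forall t, `|G t| * (1 + `|t|) ^+ 2 <= C) -> intg G.
Proof.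
move=> cG hG; have := intgZ C intg_oneDsqrV.
apply: le_integrable => //.
  by apply/measurable_EFinP; exact: continuous_measurable_fun.
move=> t _ /=; rewrite lee_fin; apply: le_trans (ler_norm _).
rewrite ler_pdivlMr ?(lt_le_trans ltr01)//; apply: le_trans (hG t).
rewrite ler_wpM2l// /oneDsqr -(real_normK (num_real t)).
by have := normr_ge0 t; nra.
Qed.

Lemma per_intg z c u F : rapid c -> sm u -> supp (z - 4^-1) (z + 4^-1) u ->
  continuous F -> poly_growth F -> intg (fun t => per z c u t * F t).
Proof.
move=> rc su hu cF [A [N hF]].
have [C C0 hC] := per_decay (N + 2) rc su hu.
apply: (@intg_decay _ (C * `|A|)) => [t|t].
  by apply: cvgM; [exact: continuous_per|exact: cF].
rewrite normrM.
have hF' : `|F t| <= `|A| * (1 + `|t|) ^+ N.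
  by apply: le_trans (hF t) _; rewrite ler_wpM2r ?ler_norm// exprn_ge0// addr_ge0.
apply: (@le_trans _ _ (`|per z c u t| * (`|A| * (1 + `|t|) ^+ N) * (1 + `|t|) ^+ 2)).
  by rewrite ler_wpM2r ?exprn_ge0 ?addr_ge0// ler_wpM2l.
rewrite (_ : _ * _ = `|per z c u t| * (1 + `|t|) ^+ (N + 2) * `|A|); last first.
  rewrite exprD; move: ((1 + `|t|) ^+ N) ((1 + `|t|) ^+ 2) => a b; ring.
by rewrite ler_wpM2r.
Qed.

Lemma symsumS (G : int -> R) M :
  symsum G M.+1 = symsum G M + (G M.+1%:Z + G (- M.+1%:Z)).
Proof. by rewrite /symsum big_ord_recr addrA. Qed.

Lemma integral_symsum (G : int -> R -> R) M : (forall n, intg (G n)) ->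
  intg (fun t => symsum (fun n => G n t) M) /\
  integral (fun t => symsum (fun n => G n t) M) = symsum (fun n => integral (G n)) M.
Proof.
move=> iG; elim: M => [|M [IH1 IH2]].
  have E : (fun t => symsum (fun n => G n t) 0) = G 0.
    by apply/funext => t; rewrite /symsum big_ord0 addr0.
  by rewrite E; split => //; rewrite /symsum big_ord0 addr0.
have E : (fun t => symsum (fun n => G n t) M.+1) =
    (fun t => symsum (fun n => G n t) M + (G M.+1%:Z t + G (- M.+1%:Z) t)).
  by apply/funext => t; rewrite symsumS.
have i2 := intgD (iG M.+1%:Z) (iG (- M.+1%:Z)).
rewrite E; split; first exact: intgD.
by rewrite (integral_add IH1 i2) IH2 integral_add// symsumS.
Qed.

(** The partial sums are truncations of [per], so its absolute value dominates them all when passing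
    to the limit under the integral. *)
Lemma symsum_per z c u t M : supp (z - 4^-1) (z + 4^-1) u ->
  symsum (fun n => c n * u (t - n%:~R)) M =
  if (`|cell z t| <= M)%N then per z c u t else 0.
Proof.
move=> hu; elim: M => [|M IH].
  rewrite /symsum big_ord0 addr0 leqn0 absz_eq0; case: eqP => [E|/eqP E].
    by rewrite /per E.
  by rewrite (u_other_cell hu) ?mulr0// eq_sym.
rewrite symsumS IH [(_ <= M.+1)%N]leq_eqVlt ltnS.
have [E|E] := eqVneq `|cell z t|%N M.+1; last first.
  rewrite /= !(u_other_cell hu) ?mulr0 ?addr0//.
    by apply: contra E => /eqP <-; rewrite abszN.
  by apply: contra E => /eqP <-.
rewrite E ltnn /= add0r.
have [h|h] : cell z t = M.+1%:Z \/ cell z t = - M.+1%:Z.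
  by case: (cell z t) E => n; [rewrite /= => ->; left|rewrite /= => -[->]; right].
- rewrite /per h [X in _ + X](_ : _ = 0) ?addr0//.
  by rewrite (u_other_cell hu) ?mulr0// h.
- rewrite /per h [X in X + _](_ : _ = 0) ?add0r//.
  by rewrite (u_other_cell hu) ?mulr0// h.
Qed.

(** Serves twice: with [F] a cosine or sine it gives the Fourier transform of the test function,
    with [F] a component of f it gives the pairing. *)
Lemma per_integral_lim z c u F : rapid c -> sm u -> supp (z - 4^-1) (z + 4^-1) u ->
  continuous F -> poly_growth F ->
  symsum (fun n => c n * integral (fun t => u t * F (t + n%:~R))) M @[M --> \oo] -->
  integral (fun t => per z c u t * F t).
Proof.
move=> rc su hu cF gF.
have iP := per_intg rc su hu cF gF.
have cs (a : R) : continuous (fun t : R => t + a).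
  by move=> t; apply: cvgD; [exact: cvg_id|exact: cvg_cst].
have cuF n : continuous (fun t => u t * F (t + n%:~R)).
  move=> t; apply: cvgM; first exact: sm_continuous.
  by apply: (@continuous_comp _ _ _ (fun t => t + n%:~R) F); [exact: cs|exact: cF].
have suF n : supp (z - 4^-1) (z + 4^-1) (fun t => u t * F (t + n%:~R)) by exact: supp_mulr.
pose G n t := c n * (u (t - n%:~R) * F t).
have GE n : G n = fun t => c n * (fun t => u t * F (t + n%:~R)) (t - n%:~R).
  by apply/funext => t /=; rewrite subrK.
have iS n : intg (fun t => (fun t => u t * F (t + n%:~R)) (t - n%:~R)).
  apply: (@continuous_supp_intg _ (z - 4^-1 + n%:~R) (z + 4^-1 + n%:~R)).
    move=> t; apply: (@continuous_comp _ _ _ (fun t => t - n%:~R) (fun t => u t * F (t + n%:~R))).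
      exact: cs.
    exact: cuF.
  move=> t ht; apply: suF; apply: contra ht => /andP[h1 h2].
  by apply/andP; split; lra.
have iG n : intg (G n) by rewrite GE; exact: intgZ.
have zz : z - 4^-1 <= z + 4^-1 by lra.
have intG n : integral (G n) = c n * integral (fun t => u t * F (t + n%:~R)).
  by rewrite GE (integral_scale _ (iS n)) (integral_shift _ zz (cuF n) (suF n)).
pose h M t := symsum (fun n => G n t) M.
have hE M t : h M t = (if (`|cell z t| <= M)%N then per z c u t else 0) * F t.
  rewrite -(symsum_per c t M hu) /h /symsum mulrDl mulr_suml /G mulrA; congr (_ + _).
  by apply: eq_bigr => i _; rewrite mulrDl !mulrA.
have ih M := integral_symsum M iG.
have := @dominated_convergence _ _ R mu setT measurableT (fun M t => (h M t)%:E)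
  (fun t => (per z c u t * F t)%:E) (fun t => `|per z c u t * F t|%:E).
case.
- by move=> M; have /integrableP[] := (ih M).1.
- by have /integrableP[] := iP.
- apply: aeW => t _; apply: cvg_near_cst; near=> M; rewrite hE ifT//.
  by near: M; exact: nbhs_infty_ge.
- exact: integrable_norm.
- apply: aeW => t M _; rewrite hE /= lee_fin; case: ifP => // _.
  by rewrite mul0r normr0.
move=> _ _.
have fin : (\int[mu]_x (per z c u x * F x)%:E)%E \is a fin_num.
  exact: (integrable_fin_num measurableT iP).
rewrite -(fineK fin) => /fine_cvg H.
suff -> : symsum (fun n => c n * integral (fun t => u t * F (t + n%:~R))) =
    fine \o (fun M => \int[mu]_x (h M x)%:E)%E by exact: H.
apply/funext => M /=; rewrite -[RHS]/(integral (h M)) (ih M).2; congr symsum.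
by apply/funext => n; rewrite intG.
Unshelve. all: by end_near. Qed.

End Periodization.

(** * Testing a function with spectrum in S against the periodized bumps *)

Section SpectralGap.
Variable R : realType.
Implicit Types (g u v w F G : R -> R) (p q t x y z : R) (k m j n : int) (c : int -> R).
Local Notation integral := (@Defs.integral R).
Local Notation pi := (@pi R).

Lemma cvgn_ext (a b : nat -> R) (l : R) : a =1 b -> a @ \oo --> l -> b @ \oo --> l.
Proof. by move=> /funext ->. Qed.

Lemma cvgnD (a b : nat -> R) la lb : a @ \oo --> la -> b @ \oo --> lb ->
  (a n + b n) @[n --> \oo] --> la + lb.
Proof. exact: cvgD. Qed.

Lemma cvgnB (a b : nat -> R) la lb : a @ \oo --> la -> b @ \oo --> lb ->
  (a n - b n) @[n --> \oo] --> la - lb.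
Proof. exact: cvgB. Qed.

Lemma cvgnZ (r : R) (a : nat -> R) la : a @ \oo --> la -> (r * a n) @[n --> \oo] --> r * la.
Proof. exact: cvgMl_tmp. Qed.

Lemma symsumD (F G : int -> R) M :
  symsum (fun n => F n + G n) M = symsum F M + symsum G M.
Proof.
rewrite /symsum addrACA -big_split/=; congr (_ + _).
by apply: eq_bigr => i _; rewrite addrACA.
Qed.

Lemma symsumZ a (F : int -> R) M : symsum (fun n => a * F n) M = a * symsum F M.
Proof.
rewrite /symsum mulrDr mulr_sumr; congr (_ + _).
by apply: eq_bigr => i _; rewrite mulrDr.
Qed.

Lemma symsumB (F G : int -> R) M :
  symsum (fun n => F n - G n) M = symsum F M - symsum G M.
Proof.
rewrite -[in RHS]mulN1r -symsumZ -symsumD.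
by congr symsum; apply/funext => n; rewrite mulN1r.
Qed.

Lemma poly_growth_le1 F : (forall t, `|F t| <= 1) -> poly_growth F.
Proof. by move=> hF; exists 1, 0%N => t; rewrite expr0 mulr1. Qed.

Section PeriodizedTestFunction.
Variables (z : R) (u : R -> R).
Hypotheses (su : sm u) (hu : supp (z - 4^-1) (z + 4^-1) u).

Lemma integral_cos_shift x n :
  integral (fun t => u t * cos (2 * pi * x * (t + n%:~R))) =
  integral (fun t => u t * cos (2 * pi * x * t)) * cos (2 * pi * n%:~R * x) -
  integral (fun t => u t * sin (2 * pi * x * t)) * sin (2 * pi * n%:~R * x).
Proof.
have i1 : intg (fun t => u t * cos (2 * pi * x * t)).
  apply: (@sm_supp_intg _ (z - 4^-1) (z + 4^-1)); last exact: supp_mulr.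
  by apply: sm_mul => //; exact: sm_cosM.
have i2 : intg (fun t => u t * sin (2 * pi * x * t)).
  apply: (@sm_supp_intg _ (z - 4^-1) (z + 4^-1)); last exact: supp_mulr.
  by apply: sm_mul => //; exact: sm_sinM.
rewrite [X in X - _]mulrC [X in _ - X]mulrC -(integral_scale _ i1) -(integral_scale _ i2).
rewrite -integral_sub; [|exact: intgZ|exact: intgZ].
congr Defs.integral; apply/funext => t.
have -> : 2 * pi * x * (t + n%:~R) = 2 * pi * x * t + 2 * pi * n%:~R * x by ring.
by rewrite cosD; ring.
Qed.

Lemma integral_sin_shift x n :
  integral (fun t => u t * sin (2 * pi * x * (t + n%:~R))) =
  integral (fun t => u t * sin (2 * pi * x * t)) * cos (2 * pi * n%:~R * x) +
  integral (fun t => u t * cos (2 * pi * x * t)) * sin (2 * pi * n%:~R * x).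
Proof.
have i1 : intg (fun t => u t * cos (2 * pi * x * t)).
  apply: (@sm_supp_intg _ (z - 4^-1) (z + 4^-1)); last exact: supp_mulr.
  by apply: sm_mul => //; exact: sm_cosM.
have i2 : intg (fun t => u t * sin (2 * pi * x * t)).
  apply: (@sm_supp_intg _ (z - 4^-1) (z + 4^-1)); last exact: supp_mulr.
  by apply: sm_mul => //; exact: sm_sinM.
rewrite [X in X + _]mulrC [X in _ + X]mulrC -(integral_scale _ i1) -(integral_scale _ i2).
rewrite -integral_add; [|exact: intgZ|exact: intgZ].
congr Defs.integral; apply/funext => t.
have -> : 2 * pi * x * (t + n%:~R) = 2 * pi * x * t + 2 * pi * n%:~R * x by ring.
by rewrite sinD; ring.
Qed.

Lemma fourier_per_vanishes (S : set R) c1 c2 : gap_seq S c1 c2 ->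
  fourier_vanishes_near (per z c1 u, per z c2 u) S.
Proof.
move=> [r1 r2 [U [oU SU hU]]]; exists U; split=> //; split=> // x Ux.
have [A0 B0] := hU _ Ux.
pose C (t : R) := cos (2 * pi * x * t); pose S0 (t : R) := sin (2 * pi * x * t).
have cC : continuous C by apply: sm_continuous; exact: sm_cosM.
have cS : continuous S0 by apply: sm_continuous; exact: sm_sinM.
have gC : poly_growth C.
  by apply: poly_growth_le1 => t; rewrite ler_norml cos_geN1 cos_le1.
have gS : poly_growth S0.
  by apply: poly_growth_le1 => t; rewrite ler_norml sin_geN1 sin_le1.
(* [al] - i [be] is the Fourier transform of [u] at x, while [A] and [B] are the parts of the
   partial sums of the series. The two cases below are the real and imaginary parts of (al - i be)(A
   + i B). *)
set al := integral (fun t => u t * C t).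
set be := integral (fun t => u t * S0 t).
set A := fun M => symsum _ M in A0; set B := fun M => symsum _ M in B0.
split.
- rewrite /fourier_re /= integral_add; [|exact: per_intg|exact: per_intg].
  have H := cvgnD (per_integral_lim r1 su hu cC gC) (per_integral_lim r2 su hu cS gS).
  rewrite -(cvg_lim (@Rhausdorff R) H).
  apply: cvg_lim => //.
  have -> : 0 = al * 0 + be * 0 :> R by rewrite !mulr0 addr0.
  have := cvgnD (cvgnZ (r := al) A0) (cvgnZ (r := be) B0).
  apply: cvgn_ext => M /=; rewrite -!symsumZ -!symsumD.
  congr symsum; apply/funext => n.
  by rewrite /C /S0 integral_cos_shift integral_sin_shift /al /be /C /S0; ring.
- rewrite /fourier_im /= integral_sub; [|exact: per_intg|exact: per_intg].
  have H := cvgnB (per_integral_lim r2 su hu cC gC) (per_integral_lim r1 su hu cS gS).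
  rewrite -(cvg_lim (@Rhausdorff R) H).
  apply: cvg_lim => //.
  have -> : 0 = al * 0 - be * 0 :> R by rewrite !mulr0 subrr.
  have := cvgnB (cvgnZ (r := al) B0) (cvgnZ (r := be) A0).
  apply: cvgn_ext => M /=.
  rewrite -!symsumZ -!symsumB.
  congr symsum; apply/funext => n.
  by rewrite /C /S0 integral_cos_shift integral_sin_shift /al /be /C /S0; ring.
Qed.

Lemma gap_pairing (S : set R) c1 c2 (f : cfun R) : gap_seq S c1 c2 -> inXS S f ->
  symsum (fun n => c1 n * integral (fun t => u t * f.1 (t + n%:~R)) +
                   - c2 n * integral (fun t => u t * f.2 (t + n%:~R))) M
    @[M --> \oo] --> (0 : R) /\
  symsum (fun n => c1 n * integral (fun t => u t * f.2 (t + n%:~R)) +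
                   c2 n * integral (fun t => u t * f.1 (t + n%:~R))) M
    @[M --> \oo] --> (0 : R).
Proof.
move=> gc [[c1f [c2f [g1f g2f]]] spf].
have [r1 r2 _] := gc.
have [|E1 E2] := spf (per z c1 u, per z c2 u) _ (fourier_per_vanishes gc).
  by split; exact: schwartzR_per.
split.
- have := cvgnB (per_integral_lim r1 su hu c1f g1f) (per_integral_lim r2 su hu c2f g2f).
  rewrite -integral_sub; [|exact: per_intg|exact: per_intg].
  rewrite [X in _ --> X -> _](_ : _ = 0); last first.
    by rewrite -E1; congr Defs.integral; apply/funext => t /=; ring.
  apply: cvgn_ext => M /=; rewrite -symsumB.
  by congr symsum; apply/funext => n; ring.
- have := cvgnD (per_integral_lim r1 su hu c2f g2f) (per_integral_lim r2 su hu c1f g1f).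
  rewrite -integral_add; [|exact: per_intg|exact: per_intg].
  rewrite [X in _ --> X -> _](_ : _ = 0); last first.
    by rewrite -E2; congr Defs.integral; apply/funext => t /=; ring.
  by apply: cvgn_ext => M /=; rewrite -symsumD.
Qed.

End PeriodizedTestFunction.

End SpectralGap.

(** * From smeared sums to point values *)

Section Estimate.
Variable R : realType.
Implicit Types (g u v w F G : R -> R) (p q t x y z : R) (k m j n : int) (c : int -> R).
Local Notation integral := (@Defs.integral R).

Lemma continuous_shift F (a : R) : continuous F -> continuous (fun t => F (t + a)).
Proof.
move=> cF t; apply: (@continuous_comp _ _ _ (fun t => t + a) F); last exact: cF.
by apply: cvgD; [exact: cvg_id|exact: cvg_cst].
Qed.

Lemma continuous_symsum (H : int -> R -> R) M : (forall n, continuous (H n)) ->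
  continuous (fun t => symsum (fun n => H n t) M).
Proof.
move=> cH; elim: M => [|M IH] t.
  have -> : (fun t => symsum (fun n => H n t) 0) = H 0.
    by apply/funext => s; rewrite /symsum big_ord0 addr0.
  exact: cH.
have -> : (fun t => symsum (fun n => H n t) M.+1) =
    (fun t => symsum (fun n => H n t) M + (H M.+1%:Z t + H (- M.+1%:Z) t)).
  by apply/funext => s; rewrite symsumS.
by apply: cvgD; [exact: IH|apply: cvgD; exact: cH].
Qed.

Lemma symsum_single (h : int -> R) m M : (`|m| <= M)%N ->
  (forall n, (`|n| <= M)%N -> n != m -> h n = 0) -> symsum h M = h m.
Proof.
elim: M => [|M IH] mM h0.
  by move: mM; rewrite leqn0 absz_eq0 => /eqP->; rewrite /symsum big_ord0 addr0.
rewrite symsumS; have [hm|hm] := leqP `|m|%N M.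
  rewrite IH//; last by move=> n nM; apply: h0; rewrite (leq_trans nM).
  rewrite (h0 M.+1%:Z)//; last by apply/eqP => E; move: hm; rewrite -E ltnn.
  rewrite (h0 (- M.+1%:Z)) ?addr0 ?abszN//.
  by apply/eqP => E; move: hm; rewrite -E abszN ltnn.
have Em : `|m|%N = M.+1 by apply/eqP; rewrite eqn_leq mM hm.
have -> : symsum h M = 0.
  rewrite /symsum h0//; last by apply/eqP => E; move: Em; rewrite -E.
  rewrite big1 ?addr0// => i _.
  rewrite !h0 ?addr0 ?abszN ?(leqW (ltn_ord i))//.
  - by apply/eqP => E; move: Em; rewrite -E abszN => -[E']; have := ltn_ord i; rewrite E' ltnn.
  - by apply/eqP => E; move: Em; rewrite -E => -[E']; have := ltn_ord i; rewrite E' ltnn.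
rewrite add0r; have [E|E] : m = M.+1%:Z \/ m = - M.+1%:Z.
  by case: (m) Em => n; [rewrite /= => ->; left|rewrite /= => -[->]; right].
- by rewrite -E [X in _ + X]h0 ?addr0// E ?abszN.
- by rewrite -E [X in X + _]h0 ?add0r// E.
Qed.

(* Shrinking [u] to a point mass at [z] turns the smeared sums into sums of
   point values, of which only [F (z + m)] survives in the range |n| <= b. *)
Lemma gap_estimate z (al be : int -> R) F G (A e : R) (N a b : nat) m :
  continuous F -> continuous G -> 0 <= A -> 0 <= e ->
  (forall t, `|F t| <= A * (1 + `|t|) ^+ N) ->
  (forall t, `|G t| <= A * (1 + `|t|) ^+ N) ->
  (a <= b)%N -> (`|m| <= a)%N -> al m = 1 -> be m = 0 ->
  (forall n, (`|n| <= a)%N -> n != m -> al n = 0 /\ be n = 0) ->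
  (forall n, (a < `|n| <= b)%N -> F (z + n%:~R) = 0 /\ G (z + n%:~R) = 0) ->
  (forall n, (b < `|n|)%N -> `|al n| * (1 + `|n%:~R|) ^+ (N + 2) <= e /\
                             `|be n| * (1 + `|n%:~R|) ^+ (N + 2) <= e) ->
  (forall u, sm u -> supp (z - 4^-1) (z + 4^-1) u ->
    symsum (fun n => al n * integral (fun t => u t * F (t + n%:~R)) +
                     be n * integral (fun t => u t * G (t + n%:~R))) M
      @[M --> \oo] --> (0 : R)) ->
  `|F (z + m%:~R)| <= 4 * e * (A * (2 + `|z|) ^+ N).
Proof.
move=> cF cG A0 e0 hF hG ab ma alm bem hin hmid htail hlim.
set T := 4 * e * (A * (2 + `|z|) ^+ N).
(* For t within 1/4 of z one has 1 + |t + n| <= (2 + |z|)(1 + |n|), so the growth splits into this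
   factor and a power of 1 + |n|. *)
set A' := A * (2 + `|z|) ^+ N.
have A'0 : 0 <= A' by rewrite mulr_ge0// exprn_ge0// addr_ge0.
pose H n t := al n * F (t + n%:~R) + be n * G (t + n%:~R).
pose g t := symsum (fun n => H n t) b.
have cH n : continuous (H n).
  move=> t; apply: cvgD; apply: cvgM; try exact: cvg_cst; exact: continuous_shift.
have cg : continuous g by exact: continuous_symsum.
have gz : g z = F (z + m%:~R).
  rewrite /g (@symsum_single _ m); first by rewrite /H alm bem mul1r mul0r addr0.
    exact: leq_trans ab.
  move=> n nb nm; rewrite /H; have [na|na] := leqP `|n|%N a.
    by have [-> ->] := hin _ na nm; rewrite !mul0r addr0.
  by have [|-> ->] := hmid n; rewrite ?na ?mulr0 ?addr0.
(* [T] does not depend on [u]: after division by the mass of [u] this bounds an average of [g] near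
   z. *)
have main u : sm u -> supp (z - 4^-1) (z + 4^-1) u -> (forall t, 0 <= u t) ->
    `|integral (fun t => u t * g t)| <= T * integral u.
  move=> su hu u0.
  have iu : intg u by exact: sm_supp_intg hu.
  have I0 : 0 <= integral u by exact: integral_nonneg.
  have iuF n F0 : continuous F0 -> intg (fun t => u t * F0 (t + n%:~R)).
    move=> cF0; apply: (@continuous_supp_intg _ (z - 4^-1) (z + 4^-1)).
      by move=> t; apply: cvgM; [exact: sm_continuous|exact: continuous_shift].
    exact: supp_mulr.
  have bnd n F0 : continuous F0 -> (forall t, `|F0 t| <= A * (1 + `|t|) ^+ N) ->
      `|integral (fun t => u t * F0 (t + n%:~R))| <=
      A' * (1 + `|n%:~R|) ^+ N * integral u.
    move=> cF0 hF0; rewrite -integral_scale//.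
    apply: normr_integral_le; [exact: iuF|exact: intgZ|move=> t].
    have [/andP[t1 t2]|ht] := boolP (z - 4^-1 <= t <= z + 4^-1); last first.
      by rewrite hu// mul0r mulr0 normr0.
    rewrite normrM ger0_norm// mulrC ler_wpM2r//.
    apply: le_trans (hF0 _) _; rewrite /A' -mulrA ler_wpM2l// -exprMn.
    apply: lerXn2r; rewrite ?nnegrE ?mulr_ge0 ?addr_ge0//.
    have h1 : `|t + n%:~R| <= `|t| + `|n%:~R : R| by exact: ler_normD.
    have h2 : `|t| <= `|z| + 1.
      rewrite -[in leLHS](subrK z t) addrC; apply: le_trans (ler_normD _ _) _.
      by rewrite lerD2l ler_norml; apply/andP; split; lra.
    have := normr_ge0 z; have := normr_ge0 (n%:~R : R); nra.
  pose s M := symsum (fun n => al n * integral (fun t => u t * F (t + n%:~R)) +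
                     be n * integral (fun t => u t * G (t + n%:~R))) M.
  have sb : integral (fun t => u t * g t) = s b.
    have iH n : intg (fun t => al n * (u t * F (t + n%:~R)) + be n * (u t * G (t + n%:~R))).
      by apply: intgD; apply: intgZ; exact: iuF.
    have [_ E] := integral_symsum b iH.
    transitivity (integral (fun t => symsum (fun n =>
        al n * (u t * F (t + n%:~R)) + be n * (u t * G (t + n%:~R))) b)).
      congr Defs.integral; apply/funext => t; rewrite /g -symsumZ.
      by congr symsum; apply/funext => n; rewrite /H; ring.
    rewrite E /s; congr symsum; apply/funext => n.
    rewrite integral_add; [|by apply: intgZ; exact: iuF|by apply: intgZ; exact: iuF].
    by rewrite !integral_scale//; exact: iuF.
  (* Of the [N + 2] powers in the hypothesis on the tail, [N] absorb the growth of [F] and [G] and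
     two remain to make the terms summable. *)
  have term n : (b < `|n|)%N ->
     `|al n * integral (fun t => u t * F (t + n%:~R)) +
       be n * integral (fun t => u t * G (t + n%:~R))| <=
     2 * e * A' * integral u / (1 + `|n%:~R|) ^+ 2.
    move=> bn; have [ha hb] := htail _ bn.
    have p0 : 0 < 1 + `|n%:~R : R| by rewrite ltr_pwDl.
    rewrite ler_pdivlMr ?exprn_gt0//.
    set X := 1 + `|n%:~R : R| in ha hb p0 *.
    have XN0 : 0 <= X ^+ N by rewrite exprn_ge0// ltW.
    have X20 : 0 <= X ^+ 2 by rewrite exprn_ge0// ltW.
    have one (r : R) F0 : continuous F0 -> (forall t, `|F0 t| <= A * (1 + `|t|) ^+ N) ->
        `|r| * X ^+ (N + 2) <= e ->
        `|r * integral (fun t => u t * F0 (t + n%:~R))| * X ^+ 2 <= e * (A' * integral u).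
      move=> cF0 hF0 hr; rewrite normrM.
      apply: (@le_trans _ _ (`|r| * (A' * X ^+ N * integral u) * X ^+ 2)).
        by rewrite ler_wpM2r// ler_wpM2l//; exact: bnd.
      have -> : `|r| * (A' * X ^+ N * integral u) * X ^+ 2 =
          `|r| * X ^+ (N + 2) * (A' * integral u).
        by rewrite exprD; move: (X ^+ N) (X ^+ 2) => ? ?; ring.
      by rewrite ler_wpM2r// mulr_ge0.
    apply: le_trans (ler_wpM2r X20 (ler_normD _ _)) _.
    rewrite mulrDl (_ : 2 * e * A' * integral u = e * (A' * integral u) + e * (A' * integral u)).
      by apply: lerD; exact: one.
    ring.
  (* The indices w + 1 and -(w + 1) both contribute, whence 4 in place of 2. With r = w + 1, the
     inequality 1/(r+1)^2 <= 1/r - 1/(r+1) makes the sum telescope, so the bound stays below [T]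
     times the mass for every [l]. *)
  have tail l : `|s (b + l)%N - s b| <=
      4 * e * A' * integral u * ((b.+1)%:R^-1 - ((b + l).+1)%:R^-1).
    elim: l => [|l IH]; first by rewrite addn0 !subrr normr0 mulr0.
    rewrite addnS /s symsumS -/(s (b + l)%N) addrAC.
    apply: le_trans (ler_normD _ _) _.
    set w := (b + l)%N in IH *.
    have bw : (b < w.+1)%N by rewrite ltnS leq_addr.
    have nE (n : int) : `|n|%N = w.+1 -> 1 + `|n%:~R : R| = w.+1%:R + 1.
      by move=> En; rewrite -intr_norm -natr_absz En addrC.
    have t1 := term w.+1%:Z bw.
    have t2 := term (- w.+1%:Z); rewrite abszN in t2; have {}t2 := t2 bw.
    rewrite (nE w.+1%:Z erefl) in t1.
    rewrite (nE (- w.+1%:Z)) ?abszN// in t2.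
    apply: le_trans (lerD IH (le_trans (ler_normD _ _) (lerD t1 t2))) _.
    set r : R := w.+1%:R; have r0 : 0 < r by rewrite ltr0n.
    have -> : w.+2%:R = r + 1 by rewrite -natr1.
    have key : ((r + 1) ^+ 2)^-1 <= r^-1 - (r + 1)^-1.
      have -> : r^-1 - (r + 1)^-1 = (r * (r + 1))^-1.
        by field; rewrite !gt_eqF//; lra.
      have p1 : 0 < (r + 1) ^+ 2 by rewrite exprn_gt0//; lra.
      have p2 : 0 < r * (r + 1) by rewrite mulr_gt0//; lra.
      by rewrite lef_pV2 ?posrE//; nra.
    have W0 : 0 <= e * A' * integral u by rewrite !mulr_ge0.
    have := ler_wpM2l W0 key.
    move: (((r + 1) ^+ 2)^-1) (r^-1) ((r + 1)^-1) (b.+1%:R^-1) (integral u) => q r1 r2 B I h.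
    lra.
  have sM l : `|s b| <= `|s (b + l)%N| + T * integral u.
    have := tail l; set D := s (b + l)%N - s b => hD.
    have -> : s b = s (b + l)%N - D by rewrite /D; ring.
    apply: le_trans (ler_normB _ _) _; rewrite lerD2l; apply: le_trans hD _.
    have W0 : 0 <= T * integral u by rewrite /T -/A' !mulr_ge0.
    rewrite /T -/A' in W0 *; apply: (ler_piMr W0).
    have : b.+1%:R^-1 <= 1 :> R by rewrite invf_le1 ?ler1n ?ltr0n.
    have : 0 <= (b + l).+1%:R^-1 :> R by rewrite invr_ge0.
    move: (b.+1%:R^-1) ((b + l).+1%:R^-1) => x y h1 h2; lra.
  rewrite sb; apply/ler_addgt0Pl => d d0.
  have /cvgrPdist_le/(_ d d0)[M0 _ hM0] := hlim u su hu.
  have := hM0 (b + M0)%N (leq_addl _ _); rewrite sub0r normrN -/(s _) => hd.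
  by apply: le_trans (sM M0) _; rewrite lerD2r.
rewrite -gz; apply/ler_addgt0Pl => d d0.
have /cvgrPdist_le/(_ d d0)/nbhs_ballP[r /= r0 hr] := cg z.
(* Radius 1/4 makes the bump admissible in [main]; r/2 keeps it where [g] differs from its value at
   z by at most [d]. *)
pose ep := Num.min (r / 2) 4^-1.
have ep0 : 0 < ep by rewrite lt_min divr_gt0//= invr_gt0.
have epr : ep <= r / 2 by rewrite ge_min lexx.
have ep4 : ep <= 4^-1 by rewrite ge_min lexx orbT.
pose u : R -> R := bumpf z ep.
have su : sm u := sm_bumpf _ _.
have hu' : supp (z - ep) (z + ep) u := @supp_bumpf _ _ _.
have hu : supp (z - 4^-1) (z + 4^-1) u by apply: suppW hu'; lra.
have u0 t : 0 <= u t by exact: bumpf_ge0.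
have iu : intg u by exact: sm_supp_intg hu.
have I0 : 0 < integral u.
  apply: (@integral_pos _ (z - ep) (z + ep)) => //; first lra.
    exact: sm_continuous.
  by move=> t ht; exact: bumpf_gt0.
have iug : intg (fun t => u t * g t).
  apply: (@continuous_supp_intg _ (z - ep) (z + ep)); last exact: supp_mulr.
  by move=> t; apply: cvgM; [exact: sm_continuous|exact: cg].
have hdiff : `|integral (fun t => g z * u t - u t * g t)| <= d * integral u.
  rewrite -integral_scale//; apply: normr_integral_le.
  - by apply: intgB => //; exact: intgZ.
  - exact: intgZ.
  move=> t; have [/andP[t1 t2]|ht] := boolP (z - ep <= t <= z + ep); last first.
    by rewrite hu'// mul0r !mulr0 subrr normr0.
  rewrite [g z * _]mulrC -mulrBr normrM ger0_norm// mulrC ler_wpM2r//.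
  apply: hr; rewrite /ball/= ltr_norml; apply/andP; split; lra.
rewrite integral_sub// in hdiff; last exact: intgZ.
rewrite integral_scale// in hdiff.
rewrite -(ler_pM2r I0) mulrDl -[in leLHS](gtr0_norm I0) -normrM.
rewrite -[g z * _](subrK (integral (fun t => u t * g t))).
apply: le_trans (ler_normD _ _) _.
by apply: lerD => //; exact: main.
Qed.

End Estimate.

(** * The blocks, the offsets and the set *)

Section Construction.
Variable R : realType.
Implicit Types (m n : int).

(** The shift in 1/(k+2) keeps the gap length below 1 already for k = 0, as [exists_gap_seq]
    demands. The exponent is the growth order [k] plus the two powers spent on summing the tail. One
    [b] has to work for all [m]. *)
Definition block (k a b : nat) : Prop := forall m, (`|m| <= a)%N ->
  exists c1 c2, [/\ gap_seq (S_delta k.+2%:R^-1) c1 c2, c1 m = 1 :> R, c2 m = 0,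
    forall n, (`|n| <= a)%N -> n != m -> c1 n = 0 /\ c2 n = 0 &
    forall n, (b < `|n|)%N ->
      `|c1 n| * (1 + `|n%:~R|) ^+ (k + 2) <= k.+1%:R^-1 /\
      `|c2 n| * (1 + `|n%:~R|) ^+ (k + 2) <= k.+1%:R^-1].

(** Apply rapid decay with one more power: the spare factor 1 + |n| exceeds C/e beyond the
    threshold. *)
Lemma rapid_tail (c : int -> R) (K : nat) (e : R) : rapid c -> 0 < e ->
  exists b : nat, forall n, (b < `|n|)%N -> `|c n| * (1 + `|n%:~R|) ^+ K <= e.
Proof.
move=> rc e0; have [C hC] := rc K.+1.
exists (Num.bound (C / e)) => n bn.
have p0 : 0 < 1 + `|n%:~R : R| by rewrite ltr_pwDl.
rewrite -(ler_pM2r p0) -mulrA -exprSr; apply: le_trans (hC n) _.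
have C0 : 0 <= C by apply: le_trans (hC 0); rewrite mulr_ge0// exprn_ge0// addr_ge0.
rewrite -ler_pdivrMl// mulrC.
have := archi_boundP (divr_ge0 C0 (ltW e0)) => /ltW h; apply: le_trans h _.
rewrite -intr_norm -natr_absz; apply: (@le_trans _ _ `|n|%:R).
  by rewrite ler_nat ltnW.
by rewrite lerDr.
Qed.

Lemma exists_block (k a : nat) : exists b, (a < b)%N /\ block k a b.
Proof.
have hk : 0 < (k.+2%:R^-1 : R) < 1.
  by rewrite invr_gt0 ltr0n/= invf_lt1 ?ltr0n// ltr1n.
have ek : 0 < k.+1%:R^-1 :> R by rewrite invr_gt0 ltr0n.
have H m : exists b : nat, exists c1 c2, [/\ gap_seq (S_delta k.+2%:R^-1) c1 c2,
    c1 m = 1 :> R, c2 m = 0,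
    forall n, (`|n| <= a)%N -> n != m -> c1 n = 0 /\ c2 n = 0 &
    forall n, (b < `|n|)%N ->
      `|c1 n| * (1 + `|n%:~R|) ^+ (k + 2) <= k.+1%:R^-1 /\
      `|c2 n| * (1 + `|n%:~R|) ^+ (k + 2) <= k.+1%:R^-1].
  pose s := [seq n <- [seq i%:Z | i <- iota 0 a.+1] ++ [seq - i%:Z | i <- iota 0 a.+1] | n != m].
  have ms : m \notin s by rewrite mem_filter eqxx.
  have [c1 [c2 [gc c1m c2m c0]]] := exists_gap_seq hk ms.
  have [r1 r2 _] := gc.
  have [b1 hb1] := rapid_tail (k + 2) r1 ek.
  have [b2 hb2] := rapid_tail (k + 2) r2 ek.
  exists (b1 + b2)%N, c1, c2; split => //.
    move=> n na nm; apply: c0; rewrite mem_filter nm mem_cat; apply/orP.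
    case: n na {nm} => n na; [left|right].
      by apply/mapP; exists n => //; rewrite mem_iota add0n ltnS.
    by apply/mapP; exists n.+1; rewrite ?NegzE// mem_iota add0n ltnS.
  move=> n hn; split; [apply: hb1|apply: hb2]; apply: leq_ltn_trans hn.
    exact: leq_addr.
  exact: leq_addl.
have [B hB] := choice H.
(* The sum over the finitely many [m] with |m| <= a dominates each of their thresholds; the summand
   [a.+1] gives a < b. *)
exists (a.+1 + \sum_(i < a.+1) (B i%:Z + B (- i%:Z)))%N; split; first by rewrite leq_addr.
move=> m ma; have [c1 [c2 [h1 h2 h3 h4 h5]]] := hB m.
exists c1, c2; split => // n hn; apply: h5; apply: leq_ltn_trans hn.
apply: (leq_trans _ (leq_addl _ _)).
have ma' : (`|m| < a.+1)%N by [].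
rewrite (bigD1 (Ordinal ma'))//= ; apply: (leq_trans _ (leq_addr _ _)).
by case: (m) => n' /=; [exact: leq_addr|rewrite NegzE; exact: leq_addl].
Qed.

(** Writing i + 1 = 2^l + j with j < 2^l, this is j / 2^l: level l lists all fractions in [0, 1)
    with denominator 2^l. *)
Definition dyadic (i : nat) : R := i.+1%:R / 2 ^+ trunc_log 2 i.+1 - 1.

Lemma dyadic_itv i : 0 <= dyadic i < 1.
Proof.
have /andP[h1 h2] := trunc_log_bounds (isT : (1 < 2)%N) (ltn0Sn i).
have p0 : 0 < 2 ^+ trunc_log 2 i.+1 :> R by rewrite exprn_gt0.
rewrite /dyadic subr_ge0 ler_pdivlMr// mul1r ltrBlDr ltr_pdivrMr// -natrX ler_nat h1/=.
by rewrite -[1 + 1]/(2%:R) -natrM ltr_nat -expnS.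
Qed.

(** Round x down to denominator 2^l, with [l] beyond both [K] and 1/e. Since the index found is at
    least the arbitrary [K], each x is approached by infinitely many terms, hence by blocks as late
    as desired. *)
Lemma dyadic_dense (x : R) (e : R) (K : nat) : 0 <= x < 1 -> 0 < e ->
  exists i, (K <= i)%N /\ `|dyadic i - x| < e.
Proof.
move=> /andP[x0 x1] e0.
pose l := (K.+1 + Num.bound e^-1)%N.
have p0 : 0 < 2 ^+ l :> R by rewrite exprn_gt0.
pose j := Num.truncn (x * 2 ^+ l).
have /andP[j1 j2] : j%:R <= x * 2 ^+ l < j.+1%:R.
  by apply: truncn_itv; rewrite mulr_ge0// ltW.
have jl : (j < 2 ^ l)%N.
  rewrite -(ltr_nat R) natrX; apply: le_lt_trans j1 _.
  by rewrite gtr_pMl.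
have l2 : (0 < 2 ^ l)%N by rewrite expn_gt0.
have lt2 : (l < 2 ^ l)%N by exact: ltn_expl.
exists (2 ^ l + j).-1; split; first by rewrite /l in lt2 *; lia.
have E : (2 ^ l + j).-1.+1 = (2 ^ l + j)%N by lia.
rewrite /dyadic E.
have -> : trunc_log 2 (2 ^ l + j) = l.
  by apply: trunc_log_eq => //; rewrite expnS; apply/andP; split; lia.
have -> : (2 ^ l + j)%:R / 2 ^+ l - 1 - x = (j%:R - x * 2 ^+ l) / 2 ^+ l :> R.
  by rewrite natrD natrX; field; rewrite gt_eqF.
rewrite normrM normfV (gtr0_norm p0) ltr_pdivrMr//.
apply: (@lt_le_trans _ _ 1).
  by rewrite -natr1 in j2; rewrite ltr_norml; apply/andP; split; lra.
have h : e^-1 < (Num.bound e^-1)%:R by apply: archi_boundP; rewrite invr_ge0 ltW.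
rewrite -ler_pdivrMl// mulr1; apply: le_trans (ltW h) _.
by rewrite -natrX ler_nat; apply: leq_trans (ltnW lt2); rewrite leq_addl.
Qed.

(* Consecutive blocks get offsets at distance at most 1/2, since every other
   offset is 1/2; this keeps the points of the set apart. *)
Definition offset (k : nat) : R := if odd k then dyadic k./2 else 2^-1.

Lemma offset_itv k : 0 <= offset k < 1.
Proof.
by rewrite /offset; case: ifP => _; [exact: dyadic_itv|apply/andP; split; lra].
Qed.

Lemma offset_step k : `|offset k.+1 - offset k| <= 2^-1.
Proof.
have /andP[h1 h2] := dyadic_itv k./2; have /andP[h3 h4] := dyadic_itv k.+1./2.
rewrite /offset oddS ler_norml; case: (odd k) => /=; apply/andP; split; lra.
Qed.

Section Positions.
Variable a : nat -> nat.
Hypotheses (a0 : a 0 = 0%N) (aS : forall k, (a k < a k.+1)%N).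

(** For t > 0 this is the k with a_k < t <= a_{k+1}; 0 is put in block 0. The recursion shows at
    once that passing from t to t + 1 changes the block by at most one. *)
Fixpoint blk (t : nat) : nat :=
  if t is t'.+1 then (if t' == a (blk t').+1 then (blk t').+1 else blk t') else 0.

Lemma blk_itv t : (a (blk t.+1) < t.+1 <= a (blk t.+1).+1)%N.
Proof.
elim: t => [|t IH].
  have a1 := aS 0; rewrite a0 in a1; rewrite /= eq_sym gtn_eqF//.
  by rewrite a0.
rewrite -[blk t.+2]/(if t.+1 == a (blk t.+1).+1 then (blk t.+1).+1 else blk t.+1).
move: IH; set k := blk t.+1 => /andP[h1 h2].
case: eqP => [E|/eqP E]; first by rewrite -E ltnS leqnn E aS.
by rewrite ltnW//= ltn_neqAle E.
Qed.

Lemma leq_a k : (k <= a k)%N.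
Proof. by elim: k => // k IH; apply: leq_ltn_trans IH (aS k). Qed.

Lemma blk_uniq t k : (a k < t <= a k.+1)%N -> blk t = k.
Proof.
have mono : {homo a : x y / (x <= y)%N}.
  by apply: homo_leq => [//|x y z|x]; [exact: leq_trans|exact: ltnW].
case: t => [|t]; first by rewrite ltn0.
move=> /andP[h1 h2]; have /andP[h3 h4] := blk_itv t.
apply/eqP; rewrite eqn_leq; apply/andP; split; rewrite leqNgt; apply/negP => h.
  by have := mono _ _ h; lia.
by have := mono _ _ h; lia.
Qed.

Definition pos n : R := n%:~R + offset (blk `|n|%N).

Lemma pos_itv n : n%:~R <= pos n < n%:~R + 1.
Proof.
have /andP[h1 h2] := offset_itv (blk `|n|%N).
by rewrite /pos lerDl h1 ltrD2l.
Qed.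

Lemma offset_blk_step t : `|offset (blk t.+1) - offset (blk t)| <= 2^-1.
Proof.
rewrite /=; case: ifP => _; first exact: offset_step.
by rewrite subrr normr0 invr_ge0.
Qed.

(** Only neighbours n and n + 1 need care, since each point stays in its unit interval. Their
    absolute values differ by 1 on either side of 0, so their blocks are equal or consecutive and
    their offsets differ by at most 1/2. *)
Lemma pos_gap n m : n < m -> pos n + 2^-1 <= pos m.
Proof.
move=> nm; have /andP[h1 h2] := pos_itv n; have /andP[h3 h4] := pos_itv m.
have [E|E] := eqVneq m (n + 1); last first.
  have : n + 2 <= m by lia.
  by rewrite -(ler_int R) intrD => h; lra.
have : `|offset (blk `|m|%N) - offset (blk `|n|%N)| <= 2^-1.
  have [E'|E'] : `|m|%N = `|n|%N.+1 \/ `|n|%N = `|m|%N.+1 by lia.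
    by rewrite E'; exact: offset_blk_step.
  by rewrite E' distrC; exact: offset_blk_step.
by rewrite /pos E intrD ler_norml => /andP[h5 h6]; lra.
Qed.

Lemma pos_inj : injective pos.
Proof.
move=> n m E; have [h|h|//] := ltgtP n m.
  by have := pos_gap h; rewrite E => ?; exfalso; lra.
by have := pos_gap h; rewrite E => ?; exfalso; lra.
Qed.

Lemma pos_uniformly_discrete : uniformly_discrete (range pos).
Proof.
exists 2^-1; split; first by rewrite invr_gt0.
move=> _ _ [n _ <-] [m _ <-] /eqP; rewrite (inj_eq pos_inj) neq_lt => /orP[h|h].
  by rewrite distrC; apply: le_trans (ler_norm _); have := pos_gap h => ?; lra.
by apply: le_trans (ler_norm _); have := pos_gap h => ?; lra.
Qed.

(** Each [n, n + 1) holds exactly one point, so a window of length r contains r of them up to an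
    error 2, which is at most e r once r >= 2/e. *)
Lemma pos_density : has_uniform_density (range pos) 1.
Proof.
move=> e e0; exists (2 / e + 1) => r x hr.
have e2 : 0 < 2 / e by rewrite divr_gt0.
have r0 : 0 <= r by lra.
(* Only indices p + i with 0 <= i < T + 2 can fall into the window, and those with 1 <= i < T
   certainly do. *)
pose p := Num.floor x; pose T := Num.truncn r.
have /andP[p1 p2] := floor_itv x; rewrite intrD -/p in p1 p2.
have /andP[T1 T2] := truncn_itv r0; rewrite -/T -natr1 in T1 T2.
pose P (i : nat) := x < pos (p + i%:Z) < x + r.
pose q := [seq i <- iota 0 (T + 2) | P i].
exists [seq pos (p + i%:Z) | i <- q]; split; [|split].
- rewrite map_inj_in_uniq; first by rewrite filter_uniq// iota_uniq.
  by move=> i j _ _ /pos_inj/addrI[].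
- move=> y; split.
    move=> /mapP[i]; rewrite mem_filter => /andP[Pi _] ->.
    by split => //; exists (p + i%:Z).
  move=> [[n _ <-] hn].
  have /andP[n1 n2] := pos_itv n; have /andP[y1 y2] := hn.
  have pn : p <= n.
    have : (p%:~R : R) < (n + 1)%:~R by rewrite intrD; lra.
    by rewrite ltr_int ltzD1.
  have [i Ei] : exists i : nat, n = p + i%:Z.
    by exists `|n - p|%N; rewrite gez0_abs ?subr_ge0// [RHS]addrC subrK.
  subst n; apply/mapP; exists i => //.
  rewrite mem_filter /P hn mem_iota/=.
  rewrite -(ltr_nat R) natrD; rewrite intrD -[(i%:Z)%:~R]/(i%:R) in n1.
  lra.
- rewrite size_map mulr1.
  have s1 : (size q <= T + 2)%N.
    by rewrite size_filter; apply: leq_trans (count_size _ _) _; rewrite size_iota.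
  have s2 : (T.-1 <= size q)%N.
    rewrite -[leqLHS](size_iota 1); apply: uniq_leq_size; first exact: iota_uniq.
    move=> i; rewrite !mem_iota mem_filter mem_iota => /andP[i1 i2].
    rewrite /P; have /andP[n1 n2] := pos_itv (p + i%:Z).
    rewrite intrD -[(i%:Z)%:~R]/(i%:R) in n1 n2.
    have i1R : 1 <= i%:R :> R by rewrite ler1n.
    have i2R : i%:R + 1 <= T%:R :> R.
      by rewrite natr1 ler_nat; move: i1 i2; move: (T); clear; lia.
    apply/and3P; split; [apply/andP; split; lra|by []|].
    by move: i1 i2; move: (T); clear; lia.
  have s1R : (size q)%:R <= T%:R + 2 :> R by rewrite -natrD ler_nat.
  have s2R : T%:R <= (size q)%:R + 1 :> R.
    by rewrite natr1 ler_nat; move: s2; move: (T) (size q); clear; lia.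
  have : 2 <= e * r by rewrite -ler_pdivrMl// mulrC; lra.
  move=> h; rewrite ler_norml; apply/andP; split; lra.
Qed.

End Positions.

End Construction.

(** * Uniqueness *)

Lemma spectrum_inS (R : realType) (f : cfun R) (S S' : set R) :
  S `<=` S' -> spectrum_in f S -> spectrum_in f S'.
Proof.
move=> SS' fS phi sphi [U [oU [S'U hU]]]; apply: fS => //.
by exists U; split => //; split => //; exact: subset_trans S'U.
Qed.

Lemma S_delta_sub (R : realType) (d d' : R) : d' <= d -> S_delta d `<=` S_delta d'.
Proof. by move=> dd x [k /andP[h1 h2]]; exists k; apply/andP; split => //; lra. Qed.

(** Apply [gap_estimate] to (c1, -c2) with (Re f, Im f) and to (c1, c2) with (Im f, Re f), the two
    parts of the pairing, at z = x_k. For |n| <= a_k the points z + n belong to no known zero of f,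
    but there the coefficients vanish except at [m]. The constant 3 bounds 2 + z. *)
Lemma block_vanish (R : realType) (a : nat -> nat) (k N : nat) (A d : R) (f : cfun R) (m : int) :
  a 0 = 0%N -> (forall i, (a i < a i.+1)%N) -> block R k (a k) (a k.+1) ->
  0 <= A -> (forall t, `|f.1 t| <= A * (1 + `|t|) ^+ N) ->
  (forall t, `|f.2 t| <= A * (1 + `|t|) ^+ N) ->
  (N <= k)%N -> (`|m| <= k)%N -> k.+2%:R^-1 <= d ->
  inXS (S_delta d) f -> (forall l, range (pos R a) l -> f.1 l = 0 /\ f.2 l = 0) ->
  `|f.1 (offset R k + m%:~R)| <= k.+1%:R^-1 * (4 * (A * 3 ^+ N)) /\
  `|f.2 (offset R k + m%:~R)| <= k.+1%:R^-1 * (4 * (A * 3 ^+ N)).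
Proof.
move=> a0 aS blkk A0 h1 h2 Nk mk kd [Xf spf] fL.
have mak : (`|m| <= a k)%N by apply: leq_trans mk (leq_a aS k).
have [c1 [c2 [gc c1m c2m c0 tl]]] := blkk m mak.
have fXS : inXS (S_delta k.+2%:R^-1) f.
  by split => //; apply: spectrum_inS spf; exact: S_delta_sub.
have [cf1 [cf2 _]] := Xf.
set z := offset R k; have /andP[z0 z1] := offset_itv R k; rewrite -/z in z0 z1.
have e0 : 0 <= k.+1%:R^-1 :> R by rewrite invr_ge0.
have mid n : (a k < `|n| <= a k.+1)%N -> f.1 (z + n%:~R) = 0 /\ f.2 (z + n%:~R) = 0.
  move=> hn; apply: fL; exists n => //.
  by rewrite /pos (blk_uniq a0 aS hn) addrC.
have mid' n hn := let: conj x y := mid n hn in conj y x.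
have tl1 n : (a k.+1 < `|n|)%N ->
    `|c1 n| * (1 + `|n%:~R|) ^+ (N + 2) <= k.+1%:R^-1 /\
    `|c2 n| * (1 + `|n%:~R|) ^+ (N + 2) <= k.+1%:R^-1.
  move=> /tl[t1 t2].
  have le : (1 + `|n%:~R : R|) ^+ (N + 2) <= (1 + `|n%:~R|) ^+ (k + 2).
    by rewrite ler_weXn2l ?lerDl// leq_add2r.
  by split; [apply: le_trans t1|apply: le_trans t2]; rewrite ler_wpM2l.
have tlN n : (a k.+1 < `|n|)%N ->
    `|c1 n| * (1 + `|n%:~R|) ^+ (N + 2) <= k.+1%:R^-1 /\
    `|- c2 n| * (1 + `|n%:~R|) ^+ (N + 2) <= k.+1%:R^-1.
  by rewrite normrN; exact: tl1.
have c0N n : (`|n| <= a k)%N -> n != m -> c1 n = 0 /\ - c2 n = 0.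
  by move=> na nm; have [-> ->] := c0 n na nm; rewrite oppr0.
have fin (x : R) : `|x| <= 4 * k.+1%:R^-1 * (A * (2 + `|z|) ^+ N) ->
    `|x| <= k.+1%:R^-1 * (4 * (A * 3 ^+ N)).
  move/le_trans; apply; rewrite -mulrA mulrCA ler_wpM2l// ler_wpM2l// ler_wpM2l//.
  by apply: lerXn2r; rewrite ?nnegrE ?addr_ge0//; rewrite ger0_norm//; lra.
split; apply: fin.
- have c2mN : - c2 m = 0 by rewrite c2m oppr0.
  apply: (gap_estimate cf1 cf2 A0 e0 h1 h2 (ltnW (aS k)) mak c1m c2mN c0N mid tlN).
  by move=> u su hu; have [] := gap_pairing su hu gc fXS.
- apply: (gap_estimate cf2 cf1 A0 e0 h2 h1 (ltnW (aS k)) mak c1m c2m c0 mid' tl1).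
  by move=> u su hu; have [] := gap_pairing su hu gc fXS.
Qed.

Lemma common_growth (R : realType) (F G : R -> R) : poly_growth F -> poly_growth G ->
  exists (A : R) (N : nat), [/\ 0 <= A, forall t, `|F t| <= A * (1 + `|t|) ^+ N &
    forall t, `|G t| <= A * (1 + `|t|) ^+ N].
Proof.
move=> [C1 [N1 h1]] [C2 [N2 h2]]; exists (`|C1| + `|C2|), (N1 + N2)%N.
have w (C A t : R) (N M : nat) : `|C| <= A -> (N <= M)%N ->
    C * (1 + `|t|) ^+ N <= A * (1 + `|t|) ^+ M.
  move=> CA NM; apply: (@le_trans _ _ (`|C| * (1 + `|t|) ^+ N)).
    by rewrite ler_wpM2r ?ler_norm// exprn_ge0// addr_ge0.
  by apply: ler_pM => //; rewrite ?exprn_ge0 ?addr_ge0// ler_weXn2l// lerDl.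
split; first by rewrite addr_ge0.
- by move=> t; apply: le_trans (h1 t) _; apply: w; rewrite ?lerDl// leq_addr.
- by move=> t; apply: le_trans (h2 t) _; apply: w; rewrite ?lerDr// leq_addl.
Qed.

Lemma pos_uniqueness (R : realType) (a : nat -> nat) (d : R) :
  a 0 = 0%N -> (forall i, (a i < a i.+1)%N) ->
  (forall k, block R k (a k) (a k.+1)) -> 0 < d ->
  uniqueness_set (range (pos R a)) (S_delta d).
Proof.
move=> a0 aS blka d0 f fXS fL x.
have [[cf1 [cf2 [g1 g2]]] _] := fXS.
have [A [N [A0 h1 h2]]] := common_growth g1 g2.
pose m := Num.floor x.
have /andP[m1 m2] := floor_itv x; rewrite intrD -/m in m1 m2.
pose D : R := 4 * (A * 3 ^+ N).
have D0 : 0 <= D by rewrite /D !mulr_ge0// exprn_ge0.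
have approx (F : R -> R) : continuous F ->
    (forall k : nat, (N <= k)%N -> (`|m| <= k)%N -> k.+2%:R^-1 <= d ->
       `|F (offset R k + m%:~R)| <= k.+1%:R^-1 * D) -> F x = 0.
  move=> cF hF; apply/normr0_eq0/le_anti; rewrite normr_ge0 andbT.
  apply/ler_addgt0Pl => e e0; rewrite addr0.
  have e2 : 0 < e / 2 by rewrite divr_gt0.
  have /cvgrPdist_le/(_ _ e2)/nbhs_ballP[r /= r0 hr] := cF x.
  (* The four summands secure, in this order, growth order at most k, |m| <= k, a gap 1/(k+2) <= d,
     and an error at most e/2. *)
  pose K := (N + `|m| + Num.bound d^-1 + Num.bound (D / (e / 2)))%N.
  have xm : 0 <= x - m%:~R < 1 by apply/andP; split; lra.
  have [i [Ki hi]] := dyadic_dense K xm r0.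
  (* Only odd blocks carry dyadic offsets, and block 2i + 1 carries [dyadic i]. *)
  pose k := i.*2.+1.
  have ik : (i <= k)%N by rewrite /k -addnn -addSn leq_addl.
  have [kN km k1 k2] : [/\ (N <= k)%N, (`|m| <= k)%N, (Num.bound d^-1 <= k)%N &
      (Num.bound (D / (e / 2)) <= k)%N].
    have := leq_trans Ki ik; rewrite /K.
    move: (Num.bound d^-1) (Num.bound (D / (e / 2))) `|m|%N => b1 b2 b3; clear.
    by move=> h; split; lia.
  have ok : offset R k = dyadic R i by rewrite /offset /k /= odd_double /= uphalf_double.
  have kb (q : R) : 0 <= q -> (Num.bound q <= k)%N -> q <= k%:R.
    by move=> q0 qk; apply: le_trans (ltW (archi_boundP q0)) _; rewrite ler_nat.
  have kd : k.+2%:R^-1 <= d.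
    rewrite invf_ple ?posrE ?ltr0n//.
    apply: (@le_trans _ _ k%:R); last by rewrite ler_nat leqW.
    by apply: kb => //; rewrite invr_ge0 ltW.
  have kD : k.+1%:R^-1 * D <= e / 2.
    rewrite mulrC ler_pdivrMr ?ltr0n// -ler_pdivrMl// mulrC.
    apply: (@le_trans _ _ k%:R); last by rewrite ler_nat.
    by apply: kb => //; rewrite divr_ge0// ltW.
  have Fk : `|F (offset R k + m%:~R)| <= e / 2.
    by apply: le_trans kD; exact: hF.
  have Fx : `|F x - F (offset R k + m%:~R)| <= e / 2.
    apply: hr; rewrite /ball/= ok distrC.
    by rewrite (_ : _ - x = dyadic R i - (x - m%:~R))//; ring.
  rewrite -(subrK (F (offset R k + m%:~R)) (F x)).
  by apply: le_trans (ler_normD _ _) _; lra.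
split; apply: approx => // k Nk mk kd.
- by have [] := block_vanish a0 aS (blka k) A0 h1 h2 Nk mk kd fXS fL.
- by have [] := block_vanish a0 aS (blka k) A0 h1 h2 Nk mk kd fXS fL.
Qed.

Theorem theorem5 (R : realType) :
  exists L : set R,
    uniformly_discrete L /\ has_uniform_density L 1 /\
    forall delta : R, 0 < delta < 1 -> uniqueness_set L (S_delta delta).
Proof.
have [B hB] := choice (fun ka : nat * nat => exists_block R ka.1 ka.2).
pose a := fix a k := if k is k'.+1 then B (k', a k') else 0%N.
have aS k : (a k < a k.+1)%N by have [] := hB (k, a k).
have blka k : block R k (a k) (a k.+1) by have [] := hB (k, a k).
exists (range (pos R a)); split; last split.
- exact: pos_uniformly_discrete.
- exact: pos_density.
- by move=> d /andP[d0 _]; apply: pos_uniqueness.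
Qed.
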